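(* Let $A$ and $B$ be two unital Banach algebras, let $A\overline{\otimes}B$ be a Banach algebra that is the completion of the algebraic tensor product $A\otimes B$ with respect to a uniform crossnorm, and consider $a\in A$ and $b\in B$. Set $\mathbb{D}=\sigma(a)\sigma_{DR}(b)\cup\sigma_{DR}(a)\sigma(b)$. (i) If $\sigma(a)=\Pi(a)\neq\{0\}$ and $\sigma_{DR}(b)\neq\emptyset$, then $\sigma_{DR}(a\otimes b)=\mathbb{D}$ if and only if $0\notin\Pi(a)$ or $0\notin\rho_{DR}(b)$. (ii) If $\sigma_{DR}(a)\neq\emptyset$ and $\sigma(b)=\Pi(b)\neq\{0\}$, then $\sigma_{DR}(a\otimes b)=\mathbb{D}$ if and only if $0\notin\rho_{DR}(a)$ or $0\notin\Pi(b)$.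
   Context: Banach algebras are complex. A norm on $A\otimes B$ is a crossnorm if $\|x\otimes y\|=\|x\|\,\|y\|$ for $x\in A$, $y\in B$; it is uniform if $\|(U\otimes V)z\|\le\|U\|\,\|V\|\,\|z\|$ for all bounded linear maps $U$ on $A$, $V$ on $B$ and all $z\in A\otimes B$. The element $a\otimes b$ is regarded as an element of the Banach algebra $A\overline{\otimes}B$. For $K,L\subseteq\mathbb{C}$, $KL=\{kl: k\in K,\ l\in L\}$ (empty if $K$ or $L$ is empty). An element $x$ of a unital Banach algebra $C$ is Drazin invertible if there exist $y\in C$ and $m\in\mathbb{N}$ (with $m\ge0$ allowed) such that $x^myx=x^m$, $yxy=y$ and $xy=yx$. The Drazin spectrum of $x$ is $\sigma_{DR}(x)=\{\lambda\in\mathbb{C}: x-\lambda\text{ is not Drazin invertible in }C\}$, and $\rho_{DR}(x)=\mathbb{C}\setminus\sigma_{DR}(x)$. $\sigma(x)$ is the usual spectrum and $\mathrm{iso}\,\sigma(x)$ is the set of its isolated points. $\Pi(x)\subseteq\mathrm{iso}\,\sigma(x)$ is the set of poles of $x$: those $\lambda_0\in\mathrm{iso}\,\sigma(x)$ that are poles of some finite order $p\ge1$ of the resolvent function $R(\cdot,x)$, i.e. in the Laurent expansion $R(\lambda,x)=\sum_{n\ge0}a_n(\lambda-\lambda_0)^n+\sum_{n\ge1}b_n(\lambda-\lambda_0)^{-n}$ around $\lambda_0$ one has $b_p\ne0$ and $b_m=0$ for all $m\ge p+1$. *)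

(* Defs.v *)
From HB Require Import structures.
From mathcomp Require Import all_boot all_order all_algebra sesquilinear.
From mathcomp Require Import all_classical all_reals all_analysis.
From mathcomp Require Export complex.

Set Implicit Arguments.
Unset Strict Implicit.
Unset Printing Implicit Defensive.

Import Order.TTheory GRing.Theory Num.Theory.
Import numFieldNormedType.Exports.

Local Open Scope classical_set_scope.
Local Open Scope ring_scope.
Local Open Scope complex_scope.

(* Unital Banach algebras over [K].  The unit is nonzero; the normalisation
   [`|1| = 1] is not imposed.
   The product is a mixin of its own, from which the [algType] structure is
   derived below: a join of [CompleteNormedModule] and [Algebra] cannot be
   declared, because rings and normed modules already meet in
   [Num.NumDomain], which has an order.  The module structure underlying the
   derived [algType] is the one of the normed module, definitionally. *)
HB.mixin Record isBanachAlgebra (K : numFieldType) A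
    & CompleteNormedModule K A := {
  banach_one : A;
  banach_mul : A -> A -> A;
  banach_mulA : associative banach_mul;
  banach_mul1x : left_id banach_one banach_mul;
  banach_mulx1 : right_id banach_one banach_mul;
  banach_mulDl : left_distributive banach_mul +%R;
  banach_mulDr : right_distributive banach_mul +%R;
  banach_one_neq0 : banach_one != 0;
  banach_scaleAl : forall (k : K) (x y : A),
    k *: banach_mul x y = banach_mul (k *: x) y;
  banach_scaleAr : forall (k : K) (x y : A),
    k *: banach_mul x y = banach_mul x (k *: y);
  banach_normM : forall x y : A, `|banach_mul x y| <= `|x| * `|y|
}.

#[short(type="banachAlgType")]
HB.structure Definition BanachAlgebra (K : numFieldType) :=
  {A of CompleteNormedModule K A & isBanachAlgebra K A}.

HB.instance Definition _ (K : numFieldType) (A : banachAlgType K) :=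
  GRing.Zmodule_isNzRing.Build (BanachAlgebra.sort A)
    (@banach_mulA K A) (@banach_mul1x K A) (@banach_mulx1 K A)
    (@banach_mulDl K A) (@banach_mulDr K A) (@banach_one_neq0 K A).
#[non_forgetful_inheritance]
HB.instance Definition _ (K : numFieldType) (A : banachAlgType K) :=
  GRing.Lmodule_isLalgebra.Build K (BanachAlgebra.sort A)
    (@banach_scaleAl K A).
#[non_forgetful_inheritance]
HB.instance Definition _ (K : numFieldType) (A : banachAlgType K) :=
  GRing.Lalgebra_isAlgebra.Build K (BanachAlgebra.sort A)
    (@banach_scaleAr K A).

Lemma normM_le (K : numFieldType) (A : banachAlgType K) (x y : A) :
  `|x * y| <= `|x| * `|y|.
Proof. exact: banach_normM. Qed.

Section Spectra.
Context {K : numFieldType} {A : banachAlgType K}.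
Implicit Types (x : A) (l : K).

Definition is_inverse x (y : A) := y * x = 1 /\ x * y = 1.

Definition invertible x := exists y, is_inverse x y.

Definition drazin_invertible x :=
  exists (y : A) (m : nat),
    [/\ x ^+ m * y * x = x ^+ m, y * x * y = y & x * y = y * x].

Definition spectrum x : set K := [set l | ~ invertible (x - l%:A)].

Definition drazin_spectrum x : set K :=
  [set l | ~ drazin_invertible (x - l%:A)].

Definition drazin_resolvent_set x : set K := ~` drazin_spectrum x.

(* [(l - x)^-1] for [l] outside the spectrum, and the junk value [0] on it;
   the opposite sign convention only negates Laurent coefficients. *)
Definition resolvent x l : A := xget 0 [set y | is_inverse (l%:A - x) y].

(* [f] has on some punctured disc around [l0] the Laurent expansion
   [f l = \sum_(n >= 0) c n (l - l0)^n + \sum_(n >= 1) d n (l - l0)^-n];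
   the value [d 0] is not used. *)
Definition laurent_expansion (f : K -> A) l0 (c d : nat -> A) :=
  \forall l \near l0^', exists s1 s2 : A,
    [/\ series (fun n => (l - l0) ^+ n *: c n) @ \oo --> s1,
        series (fun n => (l - l0) ^- n.+1 *: d n.+1) @ \oo --> s2
      & f l = s1 + s2].

Definition poles x : set K :=
  [set l0 | isolated (spectrum x) l0 /\
    exists (p : nat) (c d : nat -> A),
      [/\ (1 <= p)%N, laurent_expansion (resolvent x) l0 c d, d p != 0
        & forall m, (p < m)%N -> d m = 0]].

End Spectra.

Definition set_mul {K : pzRingType} (S T : set K) : set K :=
  [set k * l | k in S & l in T].

(* The algebraic tensor product, through its universal property. *)
Definition is_tensor_product (K : fieldType) (A B T : lmodType K)
    (t : {bilinear A -> B -> T}) :=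
  forall (W : lmodType K) (f : {bilinear A -> B -> W}),
    (exists g : {linear T -> W}, forall x y, g (t x y) = f x y) /\
    (forall g h : {linear T -> W},
       (forall x y, g (t x y) = f x y) -> (forall x y, h (t x y) = f x y) ->
       g =1 h).

Section UniformCrossnorm.
Context {R : realType}.

Definition bounded_map {A : normedModType R[i]} (U : {linear A -> A}) :=
  exists M : R[i], forall x, `|U x| <= M * `|x|.

(* Norms of [R[i]]-modules take their values in [R[i]], where they are
   nonnegative reals; [complex.Re] brings them to [R] to form the supremum. *)
Definition opnorm {A : normedModType R[i]} (U : {linear A -> A}) : R :=
  sup [set complex.Re `|U x| | x in [set x | `|x| <= 1]].

Context {A B T : normedModType R[i]} (t : {bilinear A -> B -> T}).

Definition crossnorm := forall x y, `|t x y| = `|x| * `|y|.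

(* When [t] is a tensor product, there is exactly one linear [UV] with
   [UV (t x y) = t (U x) (V y)], namely [U] tensor [V]. *)
Definition uniform_norm :=
  forall (U : {linear A -> A}) (V : {linear B -> B}) (UV : {linear T -> T}),
    bounded_map U -> bounded_map V ->
    (forall x y, UV (t x y) = t (U x) (V y)) ->
    forall z, `|UV z| <= (opnorm U)%:C * (opnorm V)%:C * `|z|.

End UniformCrossnorm.

Definition is_completion {K : numFieldType} {T : normedModType K}
    {C : completeNormedModType K} (j : {linear T -> C}) :=
  (forall z, `|j z| = `|z|) /\ dense (range j).

(* [C] is a Banach algebra completing the algebraic tensor product [T] of [A]
   and [B] normed by a uniform crossnorm, with the product determined by
   [(x (x) y) (x' (x) y') = x x' (x) y y'].  By density of the tensors the
   unit of [C] is then necessarily [j (t 1 1)]. *)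
Record tensor_completion {R : realType} {A B C : banachAlgType R[i]}
    {T : normedModType R[i]}
    (t : {bilinear A -> B -> T}) (j : {linear T -> C}) : Prop := {
  tensor_completion_tensor : is_tensor_product t;
  tensor_completion_crossnorm : crossnorm t;
  tensor_completion_uniform : uniform_norm t;
  tensor_completion_complete : is_completion j;
  tensor_completion_mul : forall x x' y y',
    j (t x y) * j (t x' y') = j (t (x * x') (y * y'))
}.

(* Main.v *)
From HB Require Import structures.
Require Import Defs.
From mathcomp Require Import all_boot all_order all_algebra sesquilinear.
From mathcomp Require Import all_classical all_reals all_analysis.
From mathcomp Require Import ring lra.

(* Idea.  A pole of [a] is a point where [a - l] is Drazin invertible, so
   [sigma(a) = Pi(a)] makes [sigma_DR(a)] empty, [sigma(a)] finite, and (by the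
   nonemptiness of spectra) writes [1] as a sum of elements [g] commuting with
   [a] and killed by a power of some [a - l], [l] in [sigma(a)].  On such a block
   [a (x) b] is [1 (x) l b] plus a commuting nilpotent; this gives
     sigma_DR(a (x) b) = (sigma(a) \ {0}) sigma_DR(b),
   where the inclusion from right to left slices a Drazin inverse in the
   completion by [phi (x) id], with [phi] a bounded form equal to [1] on an
   eigenvector of [a]: the slice is bounded because the norm is a uniform
   crossnorm.  The right-hand side differs from [sigma(a) sigma_DR(b)] exactly
   when [0] is in [sigma(a)] but not in [sigma_DR(b)].  Part (ii) is part (i)
   for the swapped tensor product. *)

Set Implicit Arguments.
Unset Strict Implicit.
Unset Printing Implicit Defensive.

Import Order.TTheory GRing.Theory Num.Theory.
Import numFieldNormedType.Exports.

Local Open Scope classical_set_scope.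
Local Open Scope ring_scope.
Local Open Scope complex_scope.

(** * Strong pi-regularity and Drazin inverses in rings *)

(** No contour integral or functional calculus enters: a spectral idempotent is [1 - u v] for a
    Drazin inverse [v] of [u = a - l], and nonemptiness of spectra comes from repeated squaring. The
    obstacle is the way back from [a (x) b] to [b]. A Drazin inverse in the completion is only a
    limit of tensors, and a slice is linear over [B] on both sides but in general not
    multiplicative, so [y x y = y] and [x y = y x] do not pass through it. What passes is the pair
    [x^m = x^(m+1) y], [x^m = z x^(m+1)] with unrelated [y] and [z]; the same pair is what a Laurent
    expansion at a pole delivers. The point [0] of sigma(a) drops out because on its block [a (x) b]
    is nilpotent, whatever [b] is. *)

Section RingDrazin.
Variable A : pzRingType.
Implicit Types (c d e r u v w x y z E F p q : A) (m n k : nat).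

Lemma expr_raise_r x y m k :
  x ^+ m = x ^+ m.+1 * y -> x ^+ m = x ^+ (m + k) * y ^+ k.
Proof.
move=> h; elim: k => [|k IH]; first by rewrite addn0 mulr1.
by rewrite {1}IH addnC exprD h mulrA -exprD -mulrA -exprS !addnS addnC.
Qed.

Lemma expr_raise_l x z m k :
  x ^+ m = z * x ^+ m.+1 -> x ^+ m = z ^+ k * x ^+ (m + k).
Proof.
move=> h; elim: k => [|k IH]; first by rewrite addn0 mul1r.
by rewrite {1}IH exprD h -mulrA -exprD mulrA -exprSr !addnS.
Qed.

(* Azumaya's theorem.  Not asking the witnesses to commute with [x] is what
   allows slice maps to transport them. *)
Lemma drazin_of_sided x y z m :
  x ^+ m = x ^+ m.+1 * y -> x ^+ m = z * x ^+ m.+1 ->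
  exists d, [/\ x ^+ m * d * x = x ^+ m, d * x * d = d & x * d = d * x].
Proof.
move=> hy hz.
have hyk k := expr_raise_r k hy.
have hzk k := expr_raise_l k hz.
have dE : x ^+ m * y ^+ m.+1 = z ^+ m.+1 * x ^+ m.
  by rewrite {1}(hzk m.+1) -mulrA -hyk.
have xd : x * (x ^+ m * y ^+ m.+1) = x ^+ m * y ^+ m.
  by rewrite mulrA -exprS exprS [y ^+ _]exprS mulrA -exprS -hy.
have dx : (x ^+ m * y ^+ m.+1) * x = z ^+ m * x ^+ m.
  by rewrite dE -mulrA -exprSr exprSr -mulrA -hz.
have xdC : x * (x ^+ m * y ^+ m.+1) = (x ^+ m * y ^+ m.+1) * x.
  by rewrite xd dx {1}(hzk m) -mulrA -hyk.
have xmd : x ^+ m.+1 * (x ^+ m * y ^+ m.+1) = x ^+ m.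
  by rewrite mulrA -exprD addnC -hyk.
exists (x ^+ m * y ^+ m.+1); split=> //.
  by rewrite -mulrA -xdC mulrA -exprSr.
by rewrite -mulrA {1}dE -mulrA [x ^+ m * _]mulrA -exprSr xmd dE.
Qed.

Section DrazinInverse.
Variables (x y : A) (m : nat).
Hypotheses (xmyx : x ^+ m * y * x = x ^+ m) (yxy : y * x * y = y).
Hypothesis xyC : x * y = y * x.

Lemma drazin_idem : x * y * (x * y) = x * y.
Proof. by rewrite -mulrA [y * _]mulrA yxy. Qed.

Lemma drazin_absorb : y * (x * y) = y.
Proof. by rewrite mulrA yxy. Qed.

Lemma drazin_expr : x ^+ m = x ^+ m.+1 * y.
Proof. by rewrite exprSr -mulrA xyC mulrA xmyx. Qed.

Lemma drazin_expr_idem : x ^+ m * (x * y) = x ^+ m.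
Proof. by rewrite mulrA -exprSr -drazin_expr. Qed.

Lemma drazin_idem_expr k : x * y = x ^+ k.+1 * y ^+ k.+1.
Proof.
rewrite -exprMn_comm //; elim: k => [|k IH]; first by rewrite expr1.
by rewrite exprS -IH drazin_idem.
Qed.

(** The idempotent [p = x y] factors through [x^m] on either side, while [1 - p] annihilates [x^m];
    hence both off-diagonal corners of [c] vanish and [c] commutes with [p]. It then commutes with
    [y], the inverse of [x] in the corner of [p]. *)
Lemma drazin_comm c : GRing.comm c x -> GRing.comm c y.
Proof.
move=> cx; set p := x * y.
have cxk k : c * x ^+ k = x ^+ k * c by exact: commrX.
have pE : p = x ^+ m * (x * y ^+ m.+1).
  by rewrite /p (drazin_idem_expr m) exprSr mulrA.
have pE' : p = y ^+ m.+1 * x * x ^+ m.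
  rewrite /p (drazin_idem_expr m) -mulrA -exprS.
  by apply: commrX; apply: commr_sym; apply: commrX; apply: commr_sym.
have xmp : x ^+ m * (1 - p) = 0 by rewrite mulrBr mulr1 drazin_expr_idem subrr.
have pxm : (1 - p) * x ^+ m = 0.
  rewrite mulrBl mul1r; suff -> : p * x ^+ m = x ^+ m by rewrite subrr.
  rewrite -{2}drazin_expr_idem; apply: commrX; apply: commr_sym.
  by apply: commrM => //; apply: commr_refl.
have pcp : p * c * (1 - p) = 0.
  by rewrite {1}pE' -!mulrA [x ^+ m * _]mulrA -cxk -!mulrA xmp !mulr0.
have qcp : (1 - p) * c * p = 0.
  by rewrite {2}pE -!mulrA [c * _]mulrA cxk !mulrA pxm !mul0r.
have cp : c * p = p * c.
  move: pcp qcp; rewrite mulrBr mulr1 => /eqP; rewrite subr_eq0 => /eqP ->.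
  by rewrite mulrBl mul1r mulrBl => /eqP; rewrite subr_eq0 => /eqP ->.
have py : p * y = y by rewrite /p xyC -mulrA drazin_absorb.
have yxp : y * x = p by rewrite -xyC.
rewrite /GRing.comm -{1}py mulrA cp -yxp -!mulrA [x * (c * _)]mulrA -cx -mulrA.
by rewrite -/p cp mulrA drazin_absorb.
Qed.

End DrazinInverse.

(** Every term of the binomial expansion contains [w^m] or [r^k]. *)
Lemma nilpotentD q w r m k : GRing.comm w r -> GRing.comm r q ->
  GRing.comm w q -> w ^+ m * q = 0 -> r ^+ k * q = 0 -> (w + r) ^+ (m + k) * q = 0.
Proof.
move=> wr rq wq wm nk; rewrite exprDn_comm // mulr_suml big1 // => -[i /= i_lt] _.
rewrite mulrnAl; have [ik|ki] := ltnP i k.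
  have -> : (m + k - i = (k - i) + m)%N by rewrite addnC addnBAC ?(ltnW ik).
  have -> : w ^+ (k - i + m) * r ^+ i * q = w ^+ (k - i) * (w ^+ m * q) * r ^+ i.
    rewrite exprD -!mulrA; congr (_ * (_ * _)).
    by apply: commr_sym; apply: commrX; apply: commr_sym.
  by rewrite wm mulr0 mul0r mul0rn.
have -> : r ^+ i = r ^+ (i - k) * r ^+ k by rewrite -exprD subnK.
by rewrite -!mulrA nk !mulr0 mul0rn.
Qed.

(* [u] is strongly pi-regular on the block [E]; for [E = 1] this is Drazin
   invertibility, and unlike the latter it is additive in [E]. *)
Definition drazin_on E u := GRing.comm E u /\
  exists m y z, E * u ^+ m = u ^+ m.+1 * y /\ E * u ^+ m = z * u ^+ m.+1.

Lemma drazin_on0 u : drazin_on 0 u.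
Proof.
split; first exact/commr_sym/commr0.
by exists 0, 0, 0; rewrite !mul0r !mulr0.
Qed.

Lemma drazin_onD E F u : drazin_on E u -> drazin_on F u -> drazin_on (E + F) u.
Proof.
move=> [Eu [m [y [z [ey ez]]]]] [Fu [n [y' [z' [fy fz]]]]].
have EuX k : E * u ^+ k = u ^+ k * E by exact: commrX.
have FuX k : F * u ^+ k = u ^+ k * F by exact: commrX.
split; first by apply: commr_sym; apply: commrD; apply: commr_sym.
exists (m + n)%N, (y + y'), (z + z'); rewrite !(mulrDl, mulrDr); split.
  congr (_ + _).
    by rewrite addnC exprD mulrA EuX -mulrA ey mulrA -exprD addnS.
  by rewrite exprD mulrA FuX -mulrA fy mulrA -exprD addnS.
congr (_ + _).
  by rewrite exprD mulrA ez -mulrA -exprD addSn.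
by rewrite addnC exprD mulrA fz -mulrA -exprD addSn.
Qed.

(** Split [E] by [p = w v]. On [E (1 - p)] both [w] and [r] are nilpotent, hence so is [u]. On [p E]
    the inverse of [w] is [v], so [u] acts as [w (1 + r v)], and the finite Neumann sum [S] inverts
    [1 + r v] up to [(r v)^k], which [E] kills. *)
Lemma drazin_on_nilpotentD E w r v m k :
  GRing.comm E w -> GRing.comm E r -> GRing.comm E v -> GRing.comm w r ->
  GRing.comm v r -> r ^+ k * E = 0 ->
  w ^+ m * v * w = w ^+ m -> v * w * v = v -> w * v = v * w ->
  drazin_on E (w + r).
Proof.
move=> Ew Er Ev wr vr rkE wmvw vwv wvC.
set u := w + r; set p := w * v.
have Eu : GRing.comm E u by apply: commrD.
have uv : GRing.comm u v.
  by apply: commr_sym; apply: commrD => //; apply: commr_sym.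
have Ep : GRing.comm E p by apply: commrM.
have rp : GRing.comm r p by apply: commrM; apply: commr_sym.
have wp : GRing.comm w p by apply: commrM => //; apply: commr_refl.
have nil0 : u ^+ (m + k) * (E * (1 - p)) = 0.
  apply: nilpotentD => //.
  - by apply: commrM; [exact: commr_sym|apply: commrB => //; exact: commr1].
  - by apply: commrM; [exact: commr_sym|apply: commrB => //; exact: commr1].
  - have -> : E * (1 - p) = (1 - p) * E.
      by apply: commrB => //; exact: commr1.
    by rewrite mulrA mulrBr mulr1 (drazin_expr_idem wmvw wvC) subrr mul0r.
  - by rewrite mulrA rkE mul0r.
pose S := \sum_(i < k) (- (r * v)) ^+ i.
have vS : GRing.comm v S.
  rewrite /GRing.comm mulr_sumr mulr_suml; apply: eq_bigr => i _.
  by apply: commrX; apply: commrN; apply: commrM => //; exact: commr_refl.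
have uS : GRing.comm u S.
  rewrite /GRing.comm mulr_sumr mulr_suml; apply: eq_bigr => i _.
  apply: commrX; apply: commrN; apply: commrM => //.
  by apply: commr_sym; apply: commrD; [exact: commr_sym|exact: commr_refl].
have ES : GRing.comm E S.
  rewrite /GRing.comm mulr_sumr mulr_suml; apply: eq_bigr => i _.
  by apply: commrX; apply: commrN; apply: commrM.
have geomS : (1 + r * v) * S = 1 - (- (r * v)) ^+ k.
  have -> : 1 + r * v = - (- (r * v) - 1) by rewrite opprB opprK.
  by rewrite mulNr -subrX1 opprB.
have pE : p * E = u * (v * S * E).
  have -> : u * (v * S * E) = p * ((1 + r * v) * S) * E.
    have pv : p * v = v by rewrite /p wvC.
    have prv : p * (r * v) = r * v by rewrite mulrA -rp -mulrA pv.
    by rewrite !mulrA mulrDr mulr1 prv /p -mulrDl.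
  have rvkE : (- (r * v)) ^+ k * E = 0.
    rewrite exprNn -mulrA exprMn_comm; last exact: commr_sym.
    have -> : r ^+ k * v ^+ k = v ^+ k * r ^+ k.
      by apply: commrX; apply: commr_sym; apply: commrX.
    by rewrite -mulrA rkE !mulr0.
  by rewrite geomS -mulrA mulrBl mul1r rvkE subr0.
have base : E * u ^+ (m + k) = u ^+ (m + k) * (p * E).
  move: nil0; rewrite mulrBr mulrBr mulr1 => /eqP; rewrite subr_eq0 => /eqP h.
  by rewrite -[p * E]Ep -h; apply: commrX.
split=> //; exists (m + k)%N, (v * S * E), (v * S * E); split.
  by rewrite base pE mulrA -exprSr.
rewrite base pE mulrA -exprSr.
apply/commr_sym/commrX/commr_sym.
by apply: commrM => //; apply: commrM.
Qed.

End RingDrazin.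

(** * Real-valued norms *)

(* Norms of [R[i]]-modules live in [R[i]]; [nrm] is their real value. *)
Definition nrm (R : realType) (V : normedZmodType R[i]) (x : V) : R :=
  complex.Re `|x|.

Section Nrm.
Variable R : realType.

Lemma nrmE (V : normedZmodType R[i]) (x : V) : `|x| = (nrm x)%:C.
Proof.
have := normr_ge0 x; rewrite /nrm; case: `|x| => r i.
by rewrite lecE /= => /andP[/eqP-> _].
Qed.

Section NormedZmod.
Variable V : normedZmodType R[i].
Implicit Types x y : V.

Lemma nrm_ge0 x : 0 <= nrm x.
Proof. by rewrite -lecR -nrmE normr_ge0. Qed.

Lemma nrm_eq0 x : (nrm x == 0) = (x == 0).
Proof. by rewrite -[x == 0]normr_eq0 nrmE -(inj_eq (@complexI R)). Qed.

Lemma nrm_gt0 x : (0 < nrm x) = (x != 0).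
Proof. by rewrite lt_neqAle nrm_ge0 andbT eq_sym nrm_eq0. Qed.

Lemma nrm0 : nrm (0 : V) = 0.
Proof. by apply/eqP; rewrite nrm_eq0. Qed.

Lemma nrmN x : nrm (- x) = nrm x.
Proof. by rewrite /nrm normrN. Qed.

Lemma nrmB x y : nrm (x - y) = nrm (y - x).
Proof. by rewrite /nrm distrC. Qed.

Lemma nrmD_le x y : nrm (x + y) <= nrm x + nrm y.
Proof. by rewrite -lecR rmorphD /= -!nrmE ler_normD. Qed.

Lemma nrmB_le x y : nrm (x - y) <= nrm x + nrm y.
Proof. by rewrite -(nrmN y) nrmD_le. Qed.

Lemma nrmBD_le z x y : nrm (x - y) <= nrm (x - z) + nrm (z - y).
Proof. by rewrite (le_trans _ (nrmD_le _ _))// addrA subrK. Qed.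

Lemma nrm_sum_le I (s : seq I) (F : I -> V) :
  nrm (\sum_(i <- s) F i) <= \sum_(i <- s) nrm (F i).
Proof.
elim: s => [|i s IH]; first by rewrite !big_nil nrm0.
by rewrite !big_cons (le_trans (nrmD_le _ _))// lerD2l.
Qed.

Lemma nrm_small_eq0 x : (forall e : R, 0 < e -> nrm x < e) -> x = 0.
Proof.
move=> h; apply/eqP; rewrite -nrm_eq0; apply/eqP/le_anti.
rewrite nrm_ge0 andbT leNgt; apply/negP => /h; by rewrite ltxx.
Qed.

End NormedZmod.

Lemma nrmM (k l : R[i]) : nrm (k * l) = nrm k * nrm l.
Proof. by apply: complexI; rewrite rmorphM /= -!nrmE normrM. Qed.

Lemma nrm1 : nrm (1 : R[i]) = 1.
Proof. by apply: complexI; rewrite -nrmE normr1. Qed.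

Lemma nrmC (r : R) : nrm r%:C = `|r|.
Proof. by apply: complexI; rewrite -nrmE normc_def /= expr0n /= addr0 sqrtr_sqr. Qed.

Lemma nrmV (k : R[i]) : nrm k^-1 = (nrm k)^-1.
Proof. by apply: complexI; rewrite fmorphV -!nrmE normfV. Qed.

Lemma nrmX (k : R[i]) n : nrm (k ^+ n) = nrm k ^+ n.
Proof. by elim: n => [|n IH]; rewrite ?nrm1 // !exprS nrmM IH. Qed.

Lemma nrmZ (V : normedModType R[i]) (k : R[i]) (x : V) :
  nrm (k *: x) = nrm k * nrm x.
Proof. by apply: complexI; rewrite rmorphM /= -!nrmE normrZ. Qed.

Lemma nrmM_le (A : banachAlgType R[i]) (x y : A) : nrm (x * y) <= nrm x * nrm y.
Proof. by rewrite -lecR rmorphM /= -!nrmE normM_le. Qed.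

Lemma nrmX_le (A : banachAlgType R[i]) (x : A) n : nrm (x ^+ n.+1) <= nrm x ^+ n.+1.
Proof.
elim: n => [|n IH]; first by rewrite !expr1.
rewrite exprS [leRHS]exprS (le_trans (nrmM_le _ _))//.
by rewrite ler_wpM2l ?nrm_ge0.
Qed.

Lemma ltc_real (e : R[i]) : 0 < e -> exists2 r : R, 0 < r & e = r%:C.
Proof.
by case: e => r i; rewrite ltcE /= => /andP[/eqP -> r0]; exists r.
Qed.

Lemma nbhs_nrmP (V : normedModType R[i]) (x : V) (P : set V) :
  nbhs x P <-> exists2 e : R, 0 < e & forall y, nrm (y - x) < e -> P y.
Proof.
rewrite -[nbhs x P]/(\near x, P x); split.
  move=> /nbhs_normP[e /= e0 h].
  have [r r0 eE] := ltc_real e0; exists r => // y yx.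
  by apply: h; rewrite /= eE distrC nrmE ltcR.
move=> [e e0 h]; apply/nbhs_normP; exists e%:C; first by rewrite /= ltcR.
by move=> y /=; rewrite distrC nrmE ltcR => /h.
Qed.

Let K : numFieldType := R[i].

Lemma dnbhs_nrmP (l : K) (P : set K) :
  (\forall x \near l^', P x) <->
  exists2 e : R, 0 < e & forall h, h != 0 -> nrm h < e -> P (l + h).
Proof.
split.
  move=> /(nbhs_nrmP (V := K)) [e e0 hP]; exists e => // h h0 he.
  apply: (hP (l + h)); first by rewrite addrC addKr.
  by rewrite -subr_eq0 addrC addKr.
move=> [e e0 hP]; apply/(nbhs_nrmP (V := K)); exists e => // y ye yl.
rewrite -(subrK l y) addrC; apply: hP => //.
by rewrite subr_eq0.
Qed.

Lemma cvg_nrmP (V : normedModType R[i]) (u : nat -> V) (l : V) :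
  u @ \oo --> l <->
  forall e : R, 0 < e -> exists N, forall n, (N <= n)%N -> nrm (u n - l) < e.
Proof.
split.
  move=> /cvgrPdist_lt h e e0.
  have [] := h e%:C; first by rewrite ltcR.
  move=> N _ hN; exists N => n Nn.
  by have := hN n Nn; rewrite /= distrC nrmE ltcR.
move=> h; apply/cvgrPdist_lt => e /ltc_real[r r0 ->].
have [N hN] := h r r0; exists N => // n /= Nn.
by rewrite distrC nrmE ltcR hN.
Qed.

Lemma cauchy_nrm_cvg (V : completeNormedModType R[i]) (u : nat -> V) :
  (forall e : R, 0 < e -> exists N, forall n m,
     (N <= n)%N -> (N <= m)%N -> nrm (u n - u m) < e) ->
  exists l : V, u @ \oo --> l.
Proof.
move=> h; have : cauchy (u @ \oo).
  apply/cauchy_exP => e /ltc_real[r r0 ->].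
  have [N hN] := h r r0; exists (u N), N => // n /= Nn.
  by rewrite -ball_normE /= nrmE ltcR hN.
by move=> /cauchy_cvgP u_cvg; exists (lim (u @ \oo)).
Qed.

End Nrm.

(** * Bounded complex linear forms *)

Section HahnBanach.
Variables (R : realType) (V : normedModType R[i]) (g : V).
Implicit Types (v w x y : V) (r s c : R) (G : set (V * R)).

(* A real-linear form on a subspace is encoded by its graph; that the relation
   is functional need not be assumed, since domination at [0] forces it. *)
Definition dominated_graph G := [/\
  forall v w r s, G (v, r) -> G (w, s) -> G (v + w, r + s),
  forall c v r, G (v, r) -> G (c%:C *: v, c * r),
  forall v r, G (v, r) -> r <= nrm v &
  G (g, nrm g)].

Lemma dominated_graph_line :
  dominated_graph [set (c%:C *: g, c * nrm g) | c in setT].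
Proof.
split.
- move=> _ _ _ _ [c _ [<- <-]] [d _ [<- <-]]; exists (c + d) => //.
  by rewrite rmorphD scalerDl mulrDl.
- move=> c _ _ [d _ [<- <-]]; exists (c * d) => //.
  by rewrite rmorphM scalerA mulrA.
- move=> _ _ [c _ [<- <-]]; rewrite nrmZ nrmC.
  by rewrite ler_wpM2r ?nrm_ge0// ler_norm.
- by exists 1 => //; rewrite rmorph1 scale1r mul1r.
Qed.

(** One-dimensional step of Hahn-Banach: a value at [v0] is admissible when it lies above every
    [r - nrm (w - v0)] and below every [nrm (w + v0) - r]. The supremum [al] of the lower bounds is
    such a value. *)
Lemma dominated_graph_extend G v0 : dominated_graph G ->
  exists2 H, dominated_graph H & G `<=` H /\ exists r, H (v0, r).
Proof.
move=> [GD GZ Gle Gg].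
pose S := [set t | exists w r, G (w, r) /\ t = r - nrm (w - v0)].
have Sub w r : G (w, r) -> ubound S (nrm (w + v0) - r).
  move=> Gw _ [w' [r' [Gw' ->]]].
  have := Gle _ _ (GD _ _ _ _ Gw Gw').
  have -> : w + w' = (w + v0) + (w' - v0) by rewrite addrACA subrr addr0.
  have := nrmD_le (w + v0) (w' - v0); lra.
have hS : has_sup S.
  split; first by exists (nrm g - nrm (g - v0)), g, (nrm g).
  by exists (nrm (g + v0) - nrm g); apply: Sub.
pose al := sup S.
have al_le w r : G (w, r) -> al <= nrm (w + v0) - r.
  by move=> Gw; apply: ge_sup; [case: hS|exact: Sub].
have le_al w r : G (w, r) -> r - nrm (w - v0) <= al.
  by move=> Gw; apply: ub_le_sup; [case: hS|exists w, r].
have G0 : G (0, 0) by have := GZ 0 _ _ Gg; rewrite rmorph0 scale0r mul0r.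
exists [set u | exists w r c, G (w, r) /\ u = (w + c%:C *: v0, r + c * al)]; last first.
  split; first by move=> [w r] Gw; exists w, r, 0; rewrite rmorph0 scale0r mul0r !addr0.
  by exists al, 0, 0, 1; rewrite rmorph1 scale1r mul1r !add0r.
split.
- move=> _ _ _ _ [w [r [c [Gw [-> ->]]]]] [w' [r' [c' [Gw' [-> ->]]]]].
  exists (w + w'), (r + r'), (c + c'); split; first exact: GD.
  by rewrite rmorphD scalerDl mulrDl (addrACA w) (addrACA r).
- move=> c _ _ [w [r [d [Gw [-> ->]]]]].
  exists (c%:C *: w), (c * r), (c * d); split; first exact: GZ.
  by rewrite rmorphM scalerDr scalerA mulrDr mulrA.
- move=> _ _ [w [r [c [Gw [-> ->]]]]].
  (* For nonzero [c], dividing [w + c v0] by the absolute value of [c] gives a vector [w' - v0] or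
     [w' + v0], so the lower bound on [al] serves [c < 0] and the upper bound [c > 0]. *)
  have [c0|c0|->] := ltgtP c 0.
  + have := le_al _ _ (GZ (- c^-1) _ _ Gw).
    have -> : (- c^-1)%:C *: w - v0 = (- c^-1)%:C *: (w + c%:C *: v0).
      rewrite scalerDr scalerA -rmorphM mulNr mulVf ?lt_eqF//.
      by rewrite rmorphN1 scaleN1r.
    rewrite nrmZ nrmC gtr0_norm ?oppr_gt0 ?invr_lt0// => h.
    have := ler_wnM2l (ltW c0) h; rewrite mulrBr !mulrA mulrN mulfV ?lt_eqF//.
    lra.
  + have := al_le _ _ (GZ c^-1 _ _ Gw).
    have -> : c^-1%:C *: w + v0 = c^-1%:C *: (w + c%:C *: v0).
      by rewrite scalerDr scalerA -rmorphM mulVf ?gt_eqF// rmorph1 scale1r.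
    rewrite nrmZ nrmC gtr0_norm ?invr_gt0// => h.
    have := ler_wpM2l (ltW c0) h; rewrite mulrBr !mulrA mulfV ?gt_eqF//.
    lra.
  + by rewrite rmorph0 scale0r mul0r !addr0; apply: Gle.
- by exists g, (nrm g), 0; rewrite rmorph0 scale0r mul0r !addr0.
Qed.

Lemma real_norming_form : exists f : V -> R,
  [/\ {morph f : x y / x + y}, forall c x, f (c%:C *: x) = c * f x,
      forall x, f x <= nrm x & f g = nrm g].
Proof.
have [|G [[->|Gdom] Gmax]] :=
  @Zorn_bigcup _ (fun G => G = set0 \/ dominated_graph G).
- move=> F FP Ftot.
  have [[X FX [u Xu]]|hF] := pselect (exists2 X, F X & X !=set0); last first.
    left; apply/seteqP; split=> // u [X FX Xu].
    by exfalso; apply: hF; exists X => //; exists u.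
  have Fdom Y (t : V * R) : F Y -> Y t -> dominated_graph Y.
    by move=> FY Yt; case: (FP Y FY) => // Y0; rewrite Y0 in Yt.
  right; split.
  + move=> v w r s [Y FY Yv] [Z FZ Zw].
    case: (Ftot _ _ FY FZ) => [YZ|ZY].
      by exists Z => //; case: (Fdom _ _ FZ Zw) => ZD *; apply: ZD => //; apply: YZ.
    by exists Y => //; case: (Fdom _ _ FY Yv) => YD *; apply: YD => //; apply: ZY.
  + move=> c v r [Y FY Yv]; exists Y => //.
    by case: (Fdom _ _ FY Yv) => _ YZ *; apply: YZ.
  + by move=> v r [Y FY Yv]; case: (Fdom _ _ FY Yv) => _ _ Yle _; apply: Yle.
  + by exists X => //; case: (Fdom _ _ FX Xu).
- case: (Gmax [set (c%:C *: g, c * nrm g) | c in setT]).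
    split; first by move=> ? [].
    by move=> /(_ (1%:C *: g, 1 * nrm g)); apply; exists 1.
  by right; exact: dominated_graph_line.
have [GD GZ Gle Gg] := Gdom.
have Gtot v : exists r, G (v, r).
  have [H Hdom [GH [r Hr]]] := dominated_graph_extend v Gdom.
  exists r; apply: contrapT => nG; apply: (Gmax H); last by right.
  by split=> // HG; apply/nG/HG.
have Gfun v r s : G (v, r) -> G (v, s) -> r = s.
  have Gle' r' s' : G (v, r') -> G (v, s') -> r' <= s'.
    move=> Gr /(GZ (-1))/(GD _ _ _ _ Gr)/Gle.
    by rewrite rmorphN1 scaleN1r mulN1r subrr nrm0 subr_le0.
  by move=> Gr Gs; apply/le_anti; rewrite !Gle'.
pose f v := projT1 (cid (Gtot v)).
have Gf v : G (v, f v) by rewrite /f; case: cid.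
exists f; split.
- by move=> x y; apply: (Gfun _ _ _ (Gf _)); apply: GD.
- by move=> c x; apply: (Gfun _ _ _ (Gf _)); apply: GZ.
- by move=> x; apply: Gle.
- exact: (Gfun _ _ _ (Gf _)).
Qed.

(** Complexification [f x - i f (i x)] of a real norming form [f]. Its real part at [g] is the norm
    of [g], so it can be normalised there; the factor [2] in the bound comes from estimating real
    and imaginary parts separately. *)
Lemma bounded_form_separating : g != 0 -> exists phi : V -> R[i],
  [/\ {morph phi : x y / x + y}, forall k x, phi (k *: x) = k * phi x,
      phi g = 1 & exists M, forall x, nrm (phi x) <= M * nrm x].
Proof.
move=> g0; have [f [fD fZ fle fg]] := real_norming_form.
have fi c x : f (Complex 0 c *: x) = c * f ('i *: x).
  by rewrite -fZ scalerA; congr f; congr (_ *: _); simpc.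
pose psi x : R[i] := f x +i* - f ('i *: x).
have psiD x y : psi (x + y) = psi x + psi y.
  by rewrite /psi scalerDr !fD opprD.
have psiZ k x : psi (k *: x) = k * psi x.
  case: k => a b.
  have kE y : f ((a +i* b) *: y) = a * f y + b * f ('i *: y).
    rewrite -fi -fZ -fD -scalerDl; congr (f (_ *: _)).
    by rewrite /real_complex_def; simpc.
  rewrite /psi; have -> : 'i *: ((a +i* b) *: x) = (a +i* b) *: ('i *: x).
    by rewrite !scalerA mulrC.
  rewrite !kE.
  have -> : f ('i *: ('i *: x)) = - f x.
    rewrite scalerA -mulN1r -fZ; congr (f (_ *: _)).
    by rewrite /real_complex_def; simpc.
  simpc; congr (_ +i* _); ring.
have psig : psi g != 0.
  apply: contra_neq g0 => /(congr1 (@complex.Re R)) /= fg0.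
  by apply/eqP; rewrite -nrm_eq0 -fg fg0.
have fabs x : `|f x| <= nrm x.
  rewrite ler_norml fle andbT lerNl -(nrmN x) (le_trans _ (fle _))//.
  have := fZ (-1) x; rewrite rmorphN1 scaleN1r => ->.
  by rewrite mulN1r.
have nrmi : nrm ('i : R[i]) = 1.
  by apply: complexI; rewrite -nrmE normc_def /= expr0n expr1n add0r sqrtr1.
exists (fun x => (psi g)^-1 * psi x); split.
- by move=> x y; rewrite psiD mulrDr.
- by move=> k x; rewrite psiZ mulrCA.
- by rewrite mulVf.
exists (nrm (psi g)^-1 * 2) => x; rewrite nrmM -mulrA ler_wpM2l ?nrm_ge0//.
have -> : psi x = (f x)%:C - 'i * (f ('i *: x))%:C.
  by rewrite /psi /real_complex_def; simpc.
rewrite (le_trans (nrmB_le _ _))// nrmM nrmi mul1r !nrmC.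
have := fabs x; have := fabs ('i *: x); rewrite nrmZ nrmi mul1r; lra.
Qed.

End HahnBanach.

(** * Quasinilpotence of elements with trivial spectrum *)

Section Complex.
Variable R : realType.
Implicit Types (z w : R[i]) (M r e : R).

Lemma nrm_complex_le (a b : R) : nrm (a +i* b) <= `|a| + `|b|.
Proof.
have -> : a +i* b = a%:C + 'i * b%:C by rewrite /real_complex_def; simpc.
rewrite (le_trans (nrmD_le _ _))// nrmM !nrmC.
suff -> : nrm ('i : R[i]) = 1 by rewrite mul1r.
by apply: complexI; rewrite -nrmE normc_def /= expr0n expr1n add0r sqrtr1.
Qed.

Lemma le_nrm_Re z : `|complex.Re z| <= nrm z.
Proof. by rewrite -lecR -nrmE normc_ge_Re. Qed.

Lemma le_nrm_Im z : `|complex.Im z| <= nrm z.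
Proof.
rewrite -lecR -nrmE normc_def lecR -sqrtr_sqr ler_sqrt ?addr_ge0 ?sqr_ge0//.
by rewrite lerDr sqr_ge0.
Qed.

(** Compactness of the square of side [2 M]. Half the radius is spent on each coordinate. *)
Lemma disc_finite_subcover M (e : R[i] -> R) : (forall z, 0 < e z) ->
  exists s : seq R[i], forall z, nrm z <= M -> exists2 c, c \in s & nrm (z - c) < e c.
Proof.
move=> e0; pose S : set R := `[- M, M]%classic.
have : compact (S `*` S) by apply: compact_setX; exact: segment_compact.
(* Finite sequences directed by inclusion: along this filter, the near-covering form of compactness
   yields one sequence that serves all points of the square. *)
pose G := filter_from setT (fun s0 : seq R[i] => [set s : seq R[i] | {subset s0 <= s}]).
have GF : ProperFilter G.
  apply: filter_from_proper; last by move=> s _; exists s.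
  apply: filter_from_filter; first by exists [::].
  move=> s t _ _; exists (s ++ t) => // r sub; split=> z zs; apply: sub;
    by rewrite mem_cat zs ?orbT.
move=> /compact_near_coveringP /(_ _ G
  (fun s p => exists2 c, c \in s & nrm ((p.1 +i* p.2) - c) < e c) _) [].
  move=> [x y] _; pose c := x +i* y.
  have e20 : 0 < e c / 2 by rewrite divr_gt0.
  exists ([set p | ball x (e c / 2) p.1 /\ ball y (e c / 2) p.2],
      [set s : seq R[i] | c \in s]).
    split; last by exists [:: c] => // s; apply; rewrite mem_head.
    exists (ball x (e c / 2), ball y (e c / 2)) => //.
    by split; apply: nbhsx_ballx.
  move=> [[x' y'] s] /= [[hx hy] cs]; exists c => //.
  move: hx hy; rewrite -!ball_normE /= => hx hy.
  have -> : (x' +i* y') - c = (x' - x) +i* (y' - y) by rewrite /c; simpc.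
  by rewrite (le_lt_trans (nrm_complex_le _ _))// [ltRHS]splitr ltrD// distrC.
move=> s _ /(_ s (fun _ => id)) cov; exists s => z zM.
have [|c cs hc] := cov (complex.Re z, complex.Im z).
  have := le_nrm_Re z; have := le_nrm_Im z.
  rewrite !ler_norml => /andP[? ?] /andP[? ?].
  by split; rewrite /S /= in_itv /=; apply/andP; split; lra.
by exists c => //; case: z {zM cov} hc.
Qed.

Lemma expr_lt_eps (q e : R) : 0 <= q < 1 -> 0 < e ->
  exists N, forall n, (N <= n)%N -> q ^+ n < e.
Proof.
move=> /andP[q0 q1] e0.
have qn1 : `|q| < 1 by rewrite ger0_norm.
have /cvgrPdist_lt/(_ e e0)[N _ hN] := cvg_expr qn1.
exists N => n Nn; have := hN n Nn; rewrite /= sub0r normrN ger0_norm ?exprn_ge0//.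
Qed.

Lemma exists_nat_gt r : exists N, r < N.+1%:R.
Proof.
exists (Num.bound `|r|); rewrite (le_lt_trans (ler_norm _))//.
by rewrite (lt_trans (archi_boundP (normr_ge0 r)))// ltr_nat.
Qed.

End Complex.

(** * Neumann series and repeated squaring in a Banach algebra *)

Section BanachAlgebra.
Variables (R : realType) (A : banachAlgType R[i]).
Implicit Types (x y f h s : A) (z w u : R[i]) (M K r rho e : R).

Lemma invertible_1B h : nrm h < 1 -> invertible (1 - h).
Proof.
move=> h1; set q := nrm h in h1; pose S n := \sum_(i < n) h ^+ i.
have q01 : 0 <= q < 1 by rewrite nrm_ge0.
have S1 n : (1 - h) * S n = 1 - h ^+ n.
  by rewrite -opprB mulNr -subrX1 opprB.
have S1' n : S n * (1 - h) = 1 - h ^+ n.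
  rewrite -S1 mulrBl mulrBr mul1r mulr1 mulr_suml mulr_sumr; congr (_ - _).
  by apply: eq_bigr => i _; rewrite -exprS -exprSr.
(* The tail starts at a positive power because the norm of [1] is not normalised: the norm of [h^n]
   is bounded by [q^n] only for [n > 0]. *)
have nrmS N k : nrm (S (N.+1 + k)%N - S N.+1) * (1 - q) <= q ^+ N.+1.
  have : nrm (S (N.+1 + k)%N - S N.+1) <= q ^+ N.+1 * \sum_(i < k) q ^+ i.
    rewrite /S big_split_ord /= addrAC subrr add0r mulr_sumr.
    rewrite (le_trans (nrm_sum_le _ _))// ler_sum// => i _.
    by rewrite addSn -exprD (le_trans (nrmX_le _ _)).
  move=> /(ler_wpM2r (_ : 0 <= 1 - q)) -/(_ _)/le_trans ->//; first lra.
  rewrite -mulrA [_ * (1 - q)]mulrC -opprB mulNr -subrX1 opprB.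
  by rewrite ler_piMr ?exprn_ge0 ?nrm_ge0// gerBl exprn_ge0 ?nrm_ge0.
have [y Sy] : exists y : A, S @ \oo --> y.
  apply: cauchy_nrm_cvg => e e0.
  have e10 : 0 < e / 2 * (1 - q) by rewrite mulr_gt0 ?divr_gt0// subr_gt0.
  have [N hN] := expr_lt_eps q01 e10; exists N.+1 => n m Nn Nm.
  have key k : (N.+1 <= k)%N -> nrm (S k - S N.+1) < e / 2.
    move=> Nk; rewrite -(subnKC Nk) -(@ltr_pM2r _ (1 - q)) ?subr_gt0//.
    by rewrite (le_lt_trans (nrmS _ _))// hN.
  rewrite (le_lt_trans (nrmBD_le (S N.+1) _ _))// [ltRHS]splitr.
  by rewrite ltrD ?key// nrmB key.
have lim0 e : 0 < e -> exists n, nrm (S n - y) < e /\ nrm (h ^+ n) < e.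
  move=> e0; have [N hN] := (cvg_nrmP _ _).1 Sy e e0.
  have [N' hN'] := expr_lt_eps q01 e0.
  exists (N + N').+1; rewrite hN; last by rewrite -addnS leq_addr.
  split=> //; rewrite (le_lt_trans (nrmX_le _ _))// hN'//.
  by rewrite -addSn leq_addl.
have small a : (forall n, nrm a <= nrm (1 - h) * nrm (S n - y) + nrm (h ^+ n)) ->
    a = 0 :> A.
  move=> ha; apply: nrm_small_eq0 => e e0.
  have c0 : 0 < nrm (1 - h) + 1 by rewrite ltr_wpDl ?nrm_ge0.
  have [n [h1n h2n]] := lim0 _ (divr_gt0 e0 c0).
  apply: (le_lt_trans (ha n)); rewrite -[ltRHS](divfK (lt0r_neq0 c0)).
  rewrite mulrDr mulr1 mulrC ler_ltD// ler_wpM2r ?nrm_ge0//; exact: ltW.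
exists y; split; apply/eqP; rewrite -subr_eq0; apply/eqP/small => n.
  have -> : y * (1 - h) - 1 = - ((S n - y) * (1 - h) + h ^+ n).
    by rewrite mulrBl S1' opprD opprB -addrA -opprD subrK.
  by rewrite nrmN (le_trans (nrmD_le _ _))// lerD2r mulrC nrmM_le.
have -> : (1 - h) * y - 1 = - ((1 - h) * (S n - y) + h ^+ n).
  by rewrite mulrBr S1 opprD opprB -addrA -opprD subrK.
by rewrite nrmN (le_trans (nrmD_le _ _))// lerD2r nrmM_le.
Qed.

Lemma is_inverse_sq x f f' : is_inverse (1 - x) f -> is_inverse (1 + x) f' ->
  is_inverse (1 - x * x) (2^-1 *: (f + f')).
Proof.
move=> [f1 f2] [f1' f2'].
have e1 : 1 - x * x = (1 - x) * (1 + x).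
  by rewrite mulrDr mulr1 mulrBl mul1r addrA subrK.
have e2 : 1 - x * x = (1 + x) * (1 - x).
  by rewrite mulrBr mulr1 mulrDl mul1r opprD addrA addrK.
have two : 2^-1 *: (1 + x + (1 - x)) = 1 :> A.
  rewrite addrACA subrr addr0 -mulr2n -(scaler_nat 2 (1 : A)) scalerA.
  by rewrite mulVf ?scale1r// pnatr_eq0.
split.
  rewrite -scalerAl -[RHS]two mulrDl {1}e1 e2 !mulrA f1 f1' !mul1r //.
rewrite -scalerAr -[RHS]two mulrDr {1}e2 e1 -!mulrA f2 f2' !mulr1 //.
Qed.

(* Whole circles are needed for the property to survive squaring of [x]. *)
Definition circle_control K e x r rho := forall u, nrm u = 1 ->
  exists f f', [/\ is_inverse (1 - (r%:C * u) *: x) f,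
    is_inverse (1 - (rho%:C * u) *: x) f', nrm f <= K & nrm (f - f') <= e].

(* [1/(1 - t^2) = (1/(1 - t) + 1/(1 + t))/2] *)
Lemma circle_control_sq K e x r rho : circle_control K e x r rho ->
  circle_control K e (x * x) (r * r) (rho * rho).
Proof.
move=> h u u1; pose v := sqrtC u.
have vv : v * v = u by rewrite -expr2 sqrtCK.
have v1 : nrm v = 1.
  have : nrm v * nrm v == 1 by rewrite -nrmM vv u1.
  rewrite -expr2 sqrf_eq1 => /orP[/eqP//|/eqP v1].
  by have := nrm_ge0 v; rewrite v1; lra.
have [f [f' [hf hf' fK ff']]] := h v v1.
have [|g [g' [hg hg' gK gg']]] := h (- v); first by rewrite nrmN.
have n2 : nrm (2^-1 : R[i]) = 2^-1.
  by rewrite nrmV -[2]/(1 + 1) -(rmorph1 (real_complex R)) -rmorphD nrmC ger0_norm.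
have sqE t : (t%:C * t%:C * u) *: (x * x) = ((t%:C * v) *: x) * ((t%:C * v) *: x).
  by rewrite -scalerAl -scalerAr scalerA -vv; congr (_ *: _); ring.
exists (2^-1 *: (f + g)), (2^-1 *: (f' + g')); rewrite !rmorphM !sqE; split.
- by apply: is_inverse_sq => //; rewrite -[_ *: x]opprK -scaleNr -mulrN.
- by apply: is_inverse_sq => //; rewrite -[_ *: x]opprK -scaleNr -mulrN.
- by rewrite nrmZ n2; have := nrmD_le f g; lra.
- rewrite -scalerBr nrmZ n2 opprD addrACA.
  by have := nrmD_le (f - f') (g - g'); lra.
Qed.

Lemma circle_control_iter K e x r rho k : circle_control K e x r rho ->
  circle_control K e (x ^+ (2 ^ k)) (r ^+ (2 ^ k)) (rho ^+ (2 ^ k)).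
Proof.
move=> h; elim: k => [|k IH]; first by rewrite expn0 !expr1.
by rewrite expnS mul2n -addnn !exprD; apply: circle_control_sq.
Qed.

(** Along squarings of [x] the term [h] at radius [r] drops below [1/(8K)], so [f - 1 = h f] has
    norm at most [1/8]. The control carries this over to [f'] with error [1/4], whence [f' - 1] has
    norm at most [3/8]. Then [h' = (f' - 1) + h' (1 - f')] bounds the norm of [h'] by [3/5]. *)
Lemma circle_control_step K x r rho : 0 <= r -> 0 <= rho -> 0 < K ->
  circle_control K 4^-1 x r rho ->
  (exists k, nrm (x ^+ (2 ^ k)) * r ^+ (2 ^ k) < 1) ->
  exists k, nrm (x ^+ (2 ^ k)) * rho ^+ (2 ^ k) < 1.
Proof.
move=> r0 rho0 K0 hc [k0 hk0]; set q := nrm _ * _ in hk0.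
have q01 : 0 <= q < 1 by rewrite hk0 mulr_ge0 ?nrm_ge0 ?exprn_ge0.
have [q0 _] := andP q01.
have d0 : 0 < (8 * K)^-1 by rewrite invr_gt0 mulr_gt0.
have [N hN] := expr_lt_eps q01 d0.
pose k := (k0 + N)%N; exists k.
have xk : nrm (x ^+ (2 ^ k)) * r ^+ (2 ^ k) < (8 * K)^-1.
  apply: (le_lt_trans _ (hN (2 ^ N)%N (ltnW (ltn_expl _ _)))) => //.
  rewrite /q exprMn -exprM -expnD ler_wpM2r ?exprn_ge0//.
  rewrite expnD exprM; have : (0 < 2 ^ N)%N by rewrite expn_gt0.
  by case: (2 ^ N)%N => // n _; exact: nrmX_le.
have [f [f' [[_ f1] [_ f1'] fK ff']]] := circle_control_iter k hc (nrm1 R).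
set h := _ *: _ in f1; set h' := _ *: _ in f1'.
have nh : nrm h < (8 * K)^-1.
  by rewrite nrmZ mulr1 nrmC ger0_norm ?exprn_ge0// mulrC.
have nh' : nrm h' = nrm (x ^+ (2 ^ k)) * rho ^+ (2 ^ k).
  by rewrite nrmZ mulr1 nrmC ger0_norm ?exprn_ge0// mulrC.
rewrite -nh'.
have hf : nrm (f - 1) <= 8^-1.
  have -> : f - 1 = h * f by rewrite -f1 mulrBl mul1r opprB addrC subrK.
  rewrite (le_trans (nrmM_le _ _))//.
  have -> : 8^-1 = (8 * K)^-1 * K :> R by rewrite invfM -mulrA mulVf ?mulr1 ?gt_eqF.
  by rewrite ler_pM ?nrm_ge0// ltW.
have hf' : nrm (f' - 1) <= 3 / 8.
  by have := nrmBD_le f f' 1; rewrite (nrmB f' f); lra.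
have h'E : h' = (f' - 1) + h' * (1 - f').
  have h'f' : h' * f' = f' - 1 by rewrite -f1' mulrBl mul1r opprB addrC subrK.
  by rewrite mulrBr mulr1 h'f' addrC subrK.
have : nrm h' <= 3 / 8 + nrm h' * (3 / 8).
  rewrite {1}h'E (le_trans (nrmD_le _ _))// lerD//.
  by rewrite (le_trans (nrmM_le _ _))// ler_wpM2l ?nrm_ge0// nrmB.
by lra.
Qed.

Section Quasinilpotent.
Variable x : A.
Hypothesis x_inv : forall z, invertible (1 - z *: x).

Let F z := projT1 (cid (x_inv z)).
Let FP z : is_inverse (1 - z *: x) (F z).
Proof. by rewrite /F; case: cid. Qed.

Let FB w z : F w - F z = (w - z) *: (F w * x * F z).
Proof.
have [w1 w2] := FP w; have [z1 z2] := FP z.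
have <- : F w * ((1 - z *: x) - (1 - w *: x)) * F z = F w - F z.
  by rewrite mulrBr mulrBl -mulrA z2 mulr1 w1 mul1r.
by rewrite opprB addrC subrKA -scalerBl -scalerAr -scalerAl.
Qed.

(** The radius [e c] is chosen so that the resolvent identity gives, for [z] near [c], a bound of
    [F z] by the norm of [F c] plus half the norm of [F z], that is by twice the norm of [F c].
    Finitely many centres cover the disc. *)
Let F_bounded M : exists2 K, 0 < K & forall z, nrm z <= M -> nrm (F z) <= K.
Proof.
pose e z := (2 * (nrm x * nrm (F z) + 1))^-1.
have e0 z : 0 < e z.
  by rewrite invr_gt0 mulr_gt0// ltr_wpDl// mulr_ge0 ?nrm_ge0.
have [s hs] := disc_finite_subcover M e0.
exists (1 + \sum_(c <- s) 2 * nrm (F c)).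
  by rewrite ltr_pwDl// sumr_ge0// => c _; rewrite mulr_ge0 ?nrm_ge0.
move=> z /hs [c cs zc].
apply: (@le_trans _ _ (2 * nrm (F c))); last first.
  rewrite (big_rem c)//= addrCA lerDl addr_ge0// sumr_ge0// => i _.
  by rewrite mulr_ge0 ?nrm_ge0.
have h1 : nrm (F z) <= nrm (F c) + nrm (z - c) * nrm (F z * x * F c).
  by rewrite -nrmZ -FB -{1}(subrK (F c) (F z)) addrC nrmD_le.
have h2 : nrm (F z * x * F c) <= nrm (F z) * (nrm x * nrm (F c)).
  rewrite -mulrA (le_trans (nrmM_le _ _))// ler_wpM2l ?nrm_ge0//.
  exact: nrmM_le.
have h3 : nrm (z - c) * (nrm x * nrm (F c)) <= 2^-1.
  have p0 : 0 <= nrm x * nrm (F c) by rewrite mulr_ge0 ?nrm_ge0.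
  apply: (@le_trans _ _ (e c * (nrm x * nrm (F c)))).
    by rewrite ler_wpM2r// ltW.
  rewrite /e invfM -mulrA ler_piMr// mulrC ler_pdivrMr ?ltr_wpDl//; lra.
have h4 : nrm (z - c) * nrm (F z * x * F c) <= nrm (F z) * 2^-1.
  rewrite (le_trans (ler_wpM2l (nrm_ge0 _) h2))// mulrCA ler_wpM2l ?nrm_ge0//.
by lra.
Qed.

(* Rickart's elementary route to the nonemptiness of the spectrum. *)
Lemma quasinilpotent M : 0 <= M ->
  exists k, nrm (x ^+ (2 ^ k)) * M ^+ (2 ^ k) < 1.
Proof.
move=> M0; have [K K0 FK] := F_bounded M.
(* With [N + 1] equal steps from [0] to [M], the resolvent identity bounds the change of [F] over
   one step by [M / (N + 1) * (K * nrm x * K)], here less than the [1/4] that a step tolerates. *)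
have [N hN] := exists_nat_gt (4 * (M * (K * nrm x * K))).
pose r i : R := M * (i%:R / N.+1%:R).
have r0 i : 0 <= r i by rewrite mulr_ge0// divr_ge0.
have rM i : (i <= N.+1)%N -> r i <= M.
  by move=> iN; rewrite ler_piMr// ler_pdivrMr// mul1r ler_nat.
suff good i : (i <= N.+1)%N -> exists k, nrm (x ^+ (2 ^ k)) * r i ^+ (2 ^ k) < 1.
  have [//|k hk] := good N.+1; exists k.
  by move: hk; rewrite /r divff ?mulr1 ?pnatr_eq0.
elim: i => [_|i IH iN].
  by exists 0%N; rewrite expn0 !expr1 /r mul0r !mulr0.
apply: (circle_control_step _ _ K0 _ (IH (ltnW iN))) => //.
move=> u u1; exists (F ((r i)%:C * u)), (F ((r i.+1)%:C * u)).
have ru j : nrm ((r j)%:C * u) = r j by rewrite nrmM u1 mulr1 nrmC ger0_norm.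
split=> //; first by rewrite FK// ru rM// ltnW.
rewrite FB nrmZ -mulrBl nrmM u1 mulr1 -rmorphB nrmC.
have -> : `|r i - r i.+1| = M / N.+1%:R.
  rewrite /r -mulrBr -mulrBl normrM ger0_norm// normrM [X in _ * (_ * X)]ger0_norm//.
  by rewrite -addn1 natrD opprD addrA subrr sub0r normrN1 mul1r.
have FF : nrm (F ((r i)%:C * u) * x * F ((r i.+1)%:C * u)) <= K * nrm x * K.
  rewrite (le_trans (nrmM_le _ _))// ler_pM ?nrm_ge0//.
    by rewrite (le_trans (nrmM_le _ _))// ler_wpM2r ?nrm_ge0// FK// ru rM// ltnW.
  by rewrite FK// ru rM.
rewrite (le_trans (ler_wpM2l _ FF)) ?divr_ge0//.
rewrite mulrAC ler_pdivrMr//; lra.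
Qed.

(** Quasinilpotence of [x] beats the geometric growth of the powers of [s]: taking [M = nrm s * t],
    some power [t^(2^k)] times the norm of [f] is below [1]. The choice [t = 1 + 1/e] makes [t >= 1]
    and [e t > 1]. *)
Lemma quasinilpotent_eq0 s f :
  (forall n, f = s ^+ n.+1 * x ^+ n.+1) -> f = 0.
Proof.
move=> fE; apply: nrm_small_eq0 => e e0.
pose t := 1 + e^-1; have t1 : 1 <= t by rewrite lerDl invr_ge0 ltW.
have t0 : 0 <= t by rewrite (le_trans _ t1).
have [k] := quasinilpotent (mulr_ge0 (nrm_ge0 s) t0).
have : (0 < 2 ^ k)%N by rewrite expn_gt0.
case: (2 ^ k)%N => // n _ hn.
have ft : nrm f * t < 1.
  apply: le_lt_trans hn; rewrite exprMn mulrA.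
  apply: ler_pM => //; first exact: nrm_ge0.
    rewrite (fE n) (le_trans (nrmM_le _ _))// mulrC ler_wpM2l ?nrm_ge0//.
    exact: nrmX_le.
  by rewrite exprS ler_peMr// exprn_ege1.
have e1 : 1 < e * t by rewrite mulrDr mulr1 mulfV ?gt_eqF// ltrDr.
by rewrite -(@ltr_pM2r _ t) ?(lt_le_trans _ t1)// (lt_trans ft).
Qed.

End Quasinilpotent.

End BanachAlgebra.

(** * Elements with finite spectrum *)

Section Spectrum.
Variables (R : realType) (A : banachAlgType R[i]).
Implicit Types (a x y c : A) (l k : R[i]).

Lemma invertibleM x y : invertible x -> invertible y -> invertible (x * y).
Proof.
move=> [x' [x1 x2]] [y' [y1 y2]]; exists (y' * x'); split.
  by rewrite mulrA -[y' * x' * x]mulrA x1 mulr1.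
by rewrite mulrA -[x * y * y']mulrA y2 mulr1.
Qed.

Lemma invertibleZ l x : l != 0 -> invertible x -> invertible (l *: x).
Proof.
move=> l0 [y [y1 y2]]; exists (l^-1 *: y); split.
  by rewrite -scalerAl -scalerAr scalerA mulVf// scale1r.
by rewrite -scalerAl -scalerAr scalerA mulfV// scale1r.
Qed.

Lemma invertible_near x l : invertible (x - l%:A) ->
  exists2 e : R, 0 < e & forall k, nrm (k - l) < e -> invertible (x - k%:A).
Proof.
move=> xl; have [y [y1 y2]] := xl.
have y0 : 0 < nrm y + 1 by rewrite ltr_wpDl ?nrm_ge0.
exists (nrm y + 1)^-1; first by rewrite invr_gt0.
move=> k kl.
have -> : x - k%:A = (x - l%:A) * (1 - (k - l) *: y).
  by rewrite mulrBr mulr1 -scalerAr y2 scalerBl opprB addrA subrK.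
apply: invertibleM => //; apply: invertible_1B; rewrite nrmZ.
have [->|yn0] := eqVneq y 0; first by rewrite nrm0 mulr0.
rewrite (lt_le_trans (_ : _ < (nrm y + 1)^-1 * nrm y))//.
  by rewrite ltr_pM2r// nrm_gt0.
by rewrite mulrC ler_pdivrMr// mul1r lerDl.
Qed.

Lemma spectrum_nrm_le x l : spectrum x l -> nrm l <= nrm x.
Proof.
move=> xl; rewrite leNgt; apply/negP => lx; apply: xl.
have l0 : l != 0 by rewrite -nrm_gt0 (le_lt_trans (nrm_ge0 x)).
have -> : x - l%:A = (- l) *: (1 - l^-1 *: x).
  by rewrite scalerBr scalerA mulNr mulfV// !scaleNr scale1r opprK addrC.
apply: invertibleZ; first by rewrite oppr_eq0.
apply: invertible_1B; rewrite nrmZ nrmV mulrC ltr_pdivrMr ?mul1r//.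
by rewrite (le_lt_trans (nrm_ge0 x)).
Qed.

(** Every complex number, in the spectrum or not, is the centre of a disc containing no other
    spectral point. Finitely many such discs cover the disc that contains the spectrum, so every
    spectral point is one of their centres. *)
Lemma isolated_spectrum_finite x :
  (forall l, spectrum x l -> isolated (spectrum x) l) ->
  exists s : seq R[i], forall l, spectrum x l -> l \in s.
Proof.
move=> iso.
have /choice [e he] : forall l, exists e : R, 0 < e /\
    forall k, k != l -> nrm (k - l) < e -> invertible (x - k%:A).
  move=> l; have [/iso[_ [V /nbhs_nrmP[e e0 eV] VE]]|] := pselect (spectrum x l).
    exists e; split=> // k kl kle; apply: contrapT => nk.
    have : (V `&` spectrum x) k by split=> //; apply: eV.
    by rewrite VE => /= /eqP; apply/negP.
  move=> /contrapT/invertible_near[e e0 h]; exists e; split=> // k _.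
  exact: h.
have [s hs] := disc_finite_subcover (nrm x) (fun l => (he l).1).
exists s => l xl; have [c cs lc] := hs l (spectrum_nrm_le xl).
have [->//|lNc] := eqVneq l c.
by case: xl; apply: (he c).2.
Qed.

Section AlgebraicInd.
Variables (a : A) (Q : A -> Prop).
Hypothesis a_drazin : forall l, drazin_invertible (a - l%:A).
Hypothesis a_fin : exists s : seq R[i], forall l, spectrum a l -> l \in s.
Hypothesis Q0 : Q 0.
Hypothesis QD : forall g h, Q g -> Q h -> Q (g + h).
Hypothesis Qnil : forall l m g,
  spectrum a l -> GRing.comm a g -> (a - l%:A) ^+ m * g = 0 -> Q g.

Let comm_shift c l : GRing.comm c a -> GRing.comm c (a - l%:A).
Proof.
by move=> ca; apply: commrB => //; rewrite /GRing.comm -scalerAl -scalerAr mulr1 mul1r.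
Qed.

(** For an idempotent [f] commuting with [a], this says that [w] inverts [a - l] in the corner
    algebra of unit [f]. *)
Let block_inverse (f : A) l (w : A) :=
  [/\ f * w = w, w * f = w, (a - l%:A) * w = f & w * (a - l%:A) = f].

(** Points are removed one at a time. At a spectral point [l0] the block [f] shrinks to [f p], where
    [p = u v] comes from the Drazin inverse; the discarded [f (1 - p)] is killed by [u^m] and falls
    under [Qnil]. Inverses at the other points are cut down by [p], with which they commute. *)
Let spectral_block (s : seq R[i]) : exists f, [/\ GRing.comm f a, f * f = f, Q (1 - f) &
  forall l, l \in s \/ ~ spectrum a l -> exists w, block_inverse f l w].
Proof.
elim: s => [|l0 s [f [fa ff Qf finv]]].
  exists 1; split; [exact/commr_sym/commr1|by rewrite mul1r|by rewrite subrr|].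
  move=> l [//|/contrapT[w [w1 w2]]].
  by exists w; split; rewrite ?mulr1 ?mul1r.
have [al0|nal0] := pselect (spectrum a l0); last first.
  exists f; split=> // l; rewrite in_cons => -[/orP[/eqP->|ls]|nal]; apply: finv.
  - by right.
  - by left.
  - by right.
set u := a - l0%:A; have [v [m [h1 h2 h3]]] := a_drazin l0.
rewrite -/u in h1 h2 h3; pose p := u * v.
have comm_p c : GRing.comm c a -> GRing.comm c p.
  move=> ca; apply: commrM; first exact: comm_shift.
  by apply: (drazin_comm h1 h2 h3); apply: comm_shift.
have fp : GRing.comm f p := comm_p _ fa.
have fu : GRing.comm f u by apply: comm_shift.
have fv : GRing.comm f v by apply: (drazin_comm h1 h2 h3).
have pp : p * p = p := drazin_idem h2.
have pv : p * v = v by rewrite /p h3 h2.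
have fpE : f * p * (f * p) = f * p.
  by rewrite mulrA -[f * p * f]mulrA -fp mulrA ff -mulrA pp.
exists (f * p); split=> //.
- by apply: commr_sym; apply: commrM; [exact: commr_sym|apply/comm_p/commr_refl].
- have -> : 1 - f * p = (1 - f) + f * (1 - p).
    by rewrite mulrBr mulr1 addrA subrK.
  apply: QD => //; apply: (@Qnil l0 m) => //.
    apply: commrM; first exact: commr_sym.
    by apply: commrB; [exact: commr1|apply/comm_p/commr_refl].
  have fum : GRing.comm f (u ^+ m) by exact: commrX.
  rewrite mulrA -fum -mulrA mulrBr mulr1 (drazin_expr_idem h1 h3) subrr mulr0 //.
- move=> l; rewrite in_cons => hl; have [->|ll0] := eqVneq l l0.
    (* On the smaller block [l0] has left the spectrum: [u v = p] and [p v = v]. *)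
    exists (f * v); split.
    + by rewrite mulrA -[f * p * f]mulrA -fp mulrA ff -mulrA pv.
    + by rewrite mulrA -[f * v * f]mulrA -fv mulrA ff -mulrA (drazin_absorb h2).
    + by rewrite mulrA -fu -mulrA.
    + by rewrite -mulrA -h3.
  have [|w [w1 w2 w3 w4]] := finv l.
    by case: hl => [/orP[/eqP ll|]|]; [rewrite ll eqxx in ll0|left|right].
  have pal : p * (a - l%:A) = (a - l%:A) * p.
    by apply: commr_sym; apply: comm_p; apply/commr_sym/comm_shift/commr_refl.
  have wp : w * p = p * w.
    rewrite -{1}w2 -mulrA fp -w3 [p * _]mulrA pal [w * (_ * p * w)]mulrA.
    by rewrite [w * (_ * p)]mulrA w4 fp -mulrA w1.
  exists (w * p); split.
  + by rewrite wp mulrA -[f * p * p]mulrA pp fp -mulrA w1.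
  + by rewrite mulrA -[w * p * f]mulrA -fp mulrA w2 -mulrA pp.
  + by rewrite mulrA w3.
  + by rewrite -mulrA pal mulrA w4.
Qed.

(* The spectral idempotents sum to [1]: on the complementary block [f] the
   element [a] would have empty spectrum. *)
Lemma algebraic_ind : Q 1.
Proof.
have [s hs] := a_fin; have [f [fa ff Qf finv]] := spectral_block s.
have {}finv l : exists w, block_inverse f l w.
  by apply: finv; have [/hs|] := pselect (spectrum a l); [left|right].
suff f0 : f = 0 by rewrite f0 subr0 in Qf.
have [w [w1 w2 w3 w4]] := finv 0.
rewrite scale0r subr0 in w3 w4.
(* For nonzero [z], [1 - z a f] is [1] on the block of [1 - f] and [- z (a - 1/z)] on that of [f];
   its inverse is glued from [1 - f] and [- w' / z]. *)
have hinv z : invertible (1 - z *: (a * f)).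
  have [->|z0] := eqVneq z 0.
    by exists 1; rewrite scale0r subr0; split; rewrite mulr1.
  have [w' [v1 v2 v3 v4]] := finv z^-1.
  have E1 : 1 - z *: (a * f) = (1 - f) - z *: ((a - z^-1%:A) * f).
    by rewrite mulrBl scalerBr -!scalerAl mul1r scalerA mulfV// scale1r opprB addrA subrK.
  have q1 : (1 - f) * (1 - f) = 1 - f.
    by rewrite mulrBr mulr1 mulrBl mul1r ff subrr subr0.
  have q2 : (1 - f) * w' = 0 by rewrite mulrBl mul1r v1 subrr.
  have q3 : w' * (1 - f) = 0 by rewrite mulrBr mulr1 v2 subrr.
  have ga : (a - z^-1%:A) * f = f * (a - z^-1%:A) by apply/commr_sym/comm_shift.
  have q4 : (1 - f) * ((a - z^-1%:A) * f) = 0.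
    by rewrite ga mulrA mulrBl mul1r ff subrr mul0r.
  have q5 : (a - z^-1%:A) * f * (1 - f) = 0.
    by rewrite -mulrA mulrBr mulr1 ff subrr mulr0.
  have fE : f = 1 - (1 - f) by rewrite subKr.
  move: q1 q2 q3 q4 q5 E1 fE; move: (1 - f) => g q1 q2 q3 q4 q5 E1 fE.
  exists (g - z^-1 *: w'); rewrite E1; split.
    rewrite mulrBl !mulrBr q1 -scalerAr q4 scaler0 subr0 -scalerAl q3 scaler0 sub0r.
    by rewrite -scalerAl -scalerAr scalerA mulVf// scale1r mulrA v4 ff opprK fE addrC subrK.
  rewrite mulrBl !mulrBr q1 -scalerAr q2 scaler0 subr0 -scalerAl q5 scaler0 sub0r.
  by rewrite -scalerAl -scalerAr scalerA mulfV// scale1r -mulrA v1 v3 opprK fE addrC subrK.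
(* Yet [a f] is invertible on the block, with inverse [w], so [f = w^n (a f)^n] for all [n > 0]. *)
apply: (quasinilpotent_eq0 hinv (s := w)) => n.
have wx : w * (a * f) = f by rewrite mulrA w4 ff.
have xw : a * f * w = f by rewrite -mulrA w1 w3.
rewrite -exprMn_comm; last by rewrite /GRing.comm wx xw.
by rewrite wx; elim: n => [|n IH]; [rewrite expr1|rewrite exprS -IH ff].
Qed.

End AlgebraicInd.

End Spectrum.

(** * Poles of the resolvent *)

Section Laurent.
Variables (R : realType) (V : normedModType R[i]).
Implicit Types (h : R[i]) (r K M : R).

Lemma nrm_le_small_eq0 (y : V) r K : 0 < r ->
  (forall h, h != 0 -> nrm h < r -> nrm y <= K * nrm h) -> y = 0.
Proof.
move=> r0 hy; apply: nrm_small_eq0 => e e0.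
have K0 : 0 < `|K| + 1 by rewrite ltr_wpDl.
pose t := Num.min (r / 2) (e / (`|K| + 1)).
have t0 : 0 < t by rewrite lt_min !divr_gt0.
have tr : t < r by rewrite gt_min; apply/orP; left; lra.
have nt : nrm t%:C = t by rewrite nrmC gtr0_norm.
have := hy t%:C; rewrite -nrm_gt0 nt => /(_ t0 tr) yt.
have te : t * (`|K| + 1) <= e by rewrite -ler_pdivlMr// ge_min lexx orbT.
have := ler_wpM2r (ltW t0) (ler_norm K); lra.
Qed.

(** Multiplying by the highest power [h^p] and letting [h] tend to [0] isolates the leading
    coefficient, which therefore vanishes; the others follow by induction. *)
Lemma principal_part_eq0 (d : nat -> V) p M r : 0 < r ->
  (forall h, h != 0 -> nrm h < r ->
    nrm (\sum_(n < p) h ^- n.+1 *: d n) <= M) ->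
  forall n, (n < p)%N -> d n = 0.
Proof.
move=> r0; elim: p => [//|p IH] bnd.
have dp : d p = 0.
  have r10 : 0 < Num.min r 1 by rewrite lt_min r0 ltr01.
  apply: (nrm_le_small_eq0 (K := M + \sum_(n < p) nrm (d n)) r10) => h h0.
  rewrite lt_min => /andP[hr h1].
  have nh0 : 0 < nrm h by rewrite nrm_gt0.
  have -> : d p = h ^+ p.+1 *: (\sum_(n < p.+1) h ^- n.+1 *: d n)
      - \sum_(n < p) h ^+ (p - n) *: d n.
    rewrite big_ord_recr /= scalerDr scalerA mulfV ?expf_neq0// scale1r.
    rewrite scaler_sumr addrAC -sumrB big1 ?add0r// => i _.
    by rewrite scalerA -exprB ?unitfE// ?subSS ?subrr// ltnW// ltnS.
  rewrite (le_trans (nrmB_le _ _))// mulrDl lerD//.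
    rewrite nrmZ nrmX exprS -mulrA mulrC ler_wpM2r ?nrm_ge0//.
    rewrite -[leRHS]mul1r ler_pM ?exprn_ge0 ?nrm_ge0 ?bnd//.
    by rewrite exprn_ile1 ?nrm_ge0// ltW.
  rewrite (le_trans (nrm_sum_le _ _))// mulr_suml ler_sum// => i _.
  rewrite nrmZ nrmX mulrC ler_wpM2l ?nrm_ge0//.
  have : (0 < p - i)%N by rewrite subn_gt0.
  case: (p - i)%N => // k _; rewrite exprS ler_piMr ?nrm_ge0//.
  by rewrite exprn_ile1 ?nrm_ge0// ltW.
move=> n; rewrite ltnS leq_eqVlt => /orP[/eqP->//|]; apply: IH => h h0 hr.
by have := bnd h h0 hr; rewrite big_ord_recr /= dp scaler0 addr0.
Qed.

Lemma cvg_series_term_bounded (t : nat -> V) (s : V) :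
  series t @ \oo --> s -> exists2 B, 0 <= B & forall n, nrm (t n) <= B.
Proof.
move=> /cvg_nrmP/(_ 1 ltr01)[N hN].
have sum0 : 0 <= \sum_(i < N) nrm (t i) by rewrite sumr_ge0// => i _; exact: nrm_ge0.
exists (2 + \sum_(i < N) nrm (t i)); first by rewrite addr_ge0.
move=> n; have [nN|Nn] := ltnP n N.
  rewrite (bigD1 (Ordinal nN))//= addrCA lerDl addr_ge0// sumr_ge0// => i _.
  exact: nrm_ge0.
have -> : t n = series t n.+1 - series t n.
  by rewrite /series /= big_nat_recr//= addrAC subrr add0r.
have := nrmBD_le s (series t n.+1) (series t n).
have := hN n Nn; have := hN n.+1 (leqW Nn); rewrite (nrmB s); lra.
Qed.

(** Abel's estimate: terms bounded by [B] at [h1] are bounded by [B q^n] at [h], with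
    [q = nrm h / nrm h1] at most [1/2], so all terms beyond the constant one add up to at most
    [2 B q]. *)
Lemma power_series_near0 (c : nat -> V) h1 (s1 : V) : h1 != 0 ->
  series (fun n => h1 ^+ n *: c n) @ \oo --> s1 ->
  exists2 K, 0 <= K & forall h (s : V), nrm h <= nrm h1 / 2 ->
    series (fun n => h ^+ n *: c n) @ \oo --> s -> nrm (s - c 0%N) <= K * nrm h.
Proof.
move=> h10 /cvg_series_term_bounded[B B0 hB].
have n1 : 0 < nrm h1 by rewrite nrm_gt0.
exists (2 * B / nrm h1); first by rewrite !mulr_ge0 ?invr_ge0 ?nrm_ge0.
move=> h s hh1 hs; pose q := nrm h / nrm h1.
have q0 : 0 <= q by rewrite divr_ge0 ?nrm_ge0.
have q1 : q <= 2^-1 by rewrite ler_pdivrMr// mulrC.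
have geo n : \sum_(i < n) q ^+ i <= 2.
  have h2 := subrX1 q n.
  have : 0 <= q ^+ n by rewrite exprn_ge0.
  have : 0 <= \sum_(i < n) q ^+ i by rewrite sumr_ge0// => i _; rewrite exprn_ge0.
  move: h2; set S := \sum_(i < n) _ => h2 S0 qn.
  have : 0 <= (2^-1 - q) * S by rewrite mulr_ge0// subr_ge0.
  lra.
have part n : nrm (series (fun n => h ^+ n *: c n) n.+1 - c 0%N) <= 2 * B / nrm h1 * nrm h.
  rewrite /series /= big_mkord big_ord_recl /= expr0 scale1r addrC addKr.
  apply: (@le_trans _ _ (B * q * \sum_(i < n) q ^+ i)); last first.
    have -> : 2 * B / nrm h1 * nrm h = B * q * 2 by rewrite /q; ring.
    by rewrite ler_wpM2l// mulr_ge0.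
  rewrite (le_trans (nrm_sum_le _ _))// mulr_sumr ler_sum// => i _.
  have hq : nrm h = q * nrm h1 by rewrite /q divfK ?gt_eqF.
  rewrite /bump leq0n add1n -mulrA -exprS nrmZ nrmX hq exprMn -mulrA [leRHS]mulrC.
  by rewrite ler_wpM2l ?exprn_ge0// -nrmX -nrmZ.
apply/ler_addgt0Pr => e e0.
have [N hN] := (cvg_nrmP _ _).1 hs e e0.
have := nrmBD_le (series (fun n => h ^+ n *: c n) N.+1) s (c 0%N).
have := hN N.+1 (leqnSn _); have := part N; rewrite (nrmB _ s).
lra.
Qed.

End Laurent.

Section Pole.
Variables (R : realType) (A : banachAlgType R[i]).
Implicit Types (x y u f : A) (h l : R[i]).

Lemma pole_expansion x l0 : poles x l0 -> exists p (c d : nat -> A) r C,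
  [/\ 0 < r, r <= 1, 0 <= C & forall h, h != 0 -> nrm h < r -> exists f s,
    [/\ (h%:A - (x - l0%:A)) * f = 1, f * (h%:A - (x - l0%:A)) = 1,
      f = s + \sum_(n < p) h ^- n.+1 *: d n & nrm (s - c 0%N) <= C * nrm h]].
Proof.
move=> [[_ [W Wl0 WE]] [p [c [d [_ lau _ dp]]]]].
have /nbhs_nrmP[e1 e10 he1] := Wl0.
have /dnbhs_nrmP[e2 e20 he2] := lau.
pose e := Num.min (Num.min e1 e2) 1.
have e0 : 0 < e by rewrite !lt_min e10 e20 ltr01.
have h1n : nrm (e / 2)%:C = e / 2 by rewrite nrmC ger0_norm// divr_ge0// ltW.
have h10 : (e / 2)%:C != 0 by rewrite -nrm_gt0 h1n divr_gt0.
have [|s1 [s2 [cs1 _ _]]] := he2 _ h10.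
  by rewrite h1n (@lt_le_trans _ _ e)//; [lra|rewrite /e !ge_min lexx orbT].
rewrite [l0 + _]addrC addrK in cs1.
have [C C0 hC] := power_series_near0 h10 cs1.
rewrite h1n in hC.
(* The regular part converges at [e / 2], and its linear estimate holds within half of that. The
   shift drops the junk value [d 0]: entry [n] is now the coefficient of [h^-(n+1)]. *)
exists p, c, (fun n => d n.+1), (e / 4), C; split=> //.
- by rewrite divr_gt0.
- have : e <= 1 by rewrite /e ge_min lexx orbT.
  by lra.
move=> h h0 he.
have hlt (e' : R) : e <= e' -> nrm h < e' by lra.
have [|s [s' [cs cs' fE]]] := he2 h h0.
  by apply: hlt; rewrite /e !ge_min lexx orbT.
rewrite [l0 + _]addrC addrK in cs cs'.
have res : is_inverse ((l0 + h)%:A - x) (resolvent x (l0 + h)).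
  apply: xgetPex; apply: contrapT => ninv.
  have : (W `&` spectrum x) (l0 + h).
    split.
      by apply: he1; rewrite addrC addKr; apply: hlt; rewrite /e !ge_min lexx.
    move=> [y [y1 y2]]; apply: ninv; exists (- y).
    by split; [rewrite mulNr -mulrN opprB|rewrite mulrN -mulNr opprB].
  rewrite WE /= => /eqP; rewrite -subr_eq0 addrC addKr; exact/negP.
exists (resolvent x (l0 + h)), s.
have -> : h%:A - (x - l0%:A) = (l0 + h)%:A - x.
  by rewrite scalerDl opprB addrA [h%:A + _]addrC.
case: res => r1 r2; split=> //.
  rewrite fE; congr (_ + _); apply/eqP; rewrite -subr_eq0; apply/eqP.
  apply: nrm_small_eq0 => eps eps0.
  have [N hN] := (cvg_nrmP _ _).1 cs' eps eps0.
  have := hN (p + N)%N (leq_addl _ _); rewrite nrmB /series /= big_mkord.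
  rewrite big_split_ord /=.
  have -> : \sum_(i < N) h ^- (p + i).+1 *: d (p + i).+1 = 0.
    by apply: big1 => i _; rewrite dp ?scaler0// ltnS leq_addr.
  by rewrite addr0.
by apply: hC => //; lra.
Qed.

(** Let [f] be the resolvent at [l0 + h]. From [u f = h f - 1], [u^p f] differs from [h^p f] by a
    bounded polynomial, and [h^p f] is bounded at a pole; so [u^p f] is bounded and its principal
    part vanishes. Letting [h] tend to [0] in [u^(p+1) f = h u^p f - u^p] gives
    [u^p = - u^(p+1) c 0], and likewise on the other side. *)
Lemma pole_drazin_invertible x l0 : poles x l0 -> drazin_invertible (x - l0%:A).
Proof.
move=> /pole_expansion[p [c [d [r [C [r0 r1 C0 exp]]]]]].
set u := x - l0%:A in exp *.
have ufC h f : (h%:A - u) * f = 1 -> f * (h%:A - u) = 1 ->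
    u * f = h *: f - 1 /\ f * u = h *: f - 1.
  rewrite mulrBl mulrBr -scalerAl -scalerAr mul1r mulr1 => h1 h2.
  by split; [rewrite -h1 subKr|rewrite -h2 subKr].
pose N k : R := \sum_(i < k) nrm (u ^+ i).
have uf_bnd k h f : nrm h <= 1 -> u * f = h *: f - 1 ->
    nrm (u ^+ k * f - h ^+ k *: f) <= N k.
  move=> h1 uf; elim: k => [|k IH].
    by rewrite !expr0 mul1r scale1r subrr nrm0 /N big_ord0.
  have -> : u ^+ k.+1 * f - h ^+ k.+1 *: f =
      h *: (u ^+ k * f - h ^+ k *: f) - u ^+ k.
    by rewrite exprSr -mulrA uf mulrBr mulr1 scalerBr scalerA -exprS -scalerAr addrAC.
  rewrite (le_trans (nrmB_le _ _))// /N big_ord_recr /= lerD2r nrmZ.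
  by rewrite (le_trans _ IH)// ler_piMl ?nrm_ge0.
pose M : R := N p + (nrm (c 0%N) + C + \sum_(n < p) nrm (d n)).
have bnd h f s : h != 0 -> nrm h < r -> u * f = h *: f - 1 ->
    f = s + \sum_(n < p) h ^- n.+1 *: d n -> nrm (s - c 0%N) <= C * nrm h ->
    nrm (u ^+ p * f) <= M.
  move=> h0 hr uf fE sc; have h1 : nrm h <= 1 by apply: ltW; lra.
  rewrite -(subrK (h ^+ p *: f) (u ^+ p * f)) (le_trans (nrmD_le _ _))// lerD ?uf_bnd//.
  rewrite fE scalerDr (le_trans (nrmD_le _ _))// lerD//.
    rewrite nrmZ nrmX -[leRHS]mul1r ler_pM ?exprn_ge0 ?nrm_ge0//.
      by rewrite exprn_ile1 ?nrm_ge0.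
    have := nrmD_le (s - c 0%N) (c 0%N); rewrite subrK.
    have : C * nrm h <= C by rewrite ler_piMr.
    lra.
  rewrite scaler_sumr (le_trans (nrm_sum_le _ _))// ler_sum// => i _.
  rewrite scalerA -exprB ?unitfE// nrmZ nrmX ler_piMl ?nrm_ge0//.
  by rewrite exprn_ile1 ?nrm_ge0.
(* A bounded linear [L] stands for left and for right multiplication by [u^p] alike. *)
have kill (L : A -> A) (Q : R) : {morph L : y z / y + z} ->
    (forall k y, L (k *: y) = k *: L y) -> (forall y, nrm (L y) <= Q * nrm y) ->
    (forall h f s, h != 0 -> nrm h < r -> u * f = h *: f - 1 ->
      f * u = h *: f - 1 -> f = s + \sum_(n < p) h ^- n.+1 *: d n ->
      nrm (s - c 0%N) <= C * nrm h -> nrm (L f) <= M) ->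
    forall n, (n < p)%N -> L (d n) = 0.
  move=> LD LZ LQ LM; have L0 : L 0 = 0 by have := LZ 0 0; rewrite !scale0r.
  have Q0 : 0 <= Q.
    have := LQ 1; have := nrm_ge0 (L 1).
    have : 0 < nrm (1 : A) by rewrite nrm_gt0 oner_eq0.
    move=> n1 h1 h2; by rewrite -(pmulr_lge0 _ n1) (le_trans h1 h2).
  apply: (@principal_part_eq0 _ _ (fun n => L (d n)) p
    (M + Q * (nrm (c 0%N) + C)) _ r0) => h h0 hr.
  have [f [s [f1 f2 fE sc]]] := exp h h0 hr; have [uf fu] := ufC _ _ f1 f2.
  have -> : \sum_(n < p) h ^- n.+1 *: L (d n) = L f - L s.
    have -> : L f = L s + L (\sum_(n < p) h ^- n.+1 *: d n) by rewrite fE LD.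
    rewrite addrC addKr (big_morph L LD L0).
    by apply: eq_bigr => i _; rewrite LZ.
  rewrite (le_trans (nrmB_le _ _))// lerD//; first exact: (LM h f s).
  rewrite (le_trans (LQ _))// ler_wpM2l//.
  have := nrmD_le (s - c 0%N) (c 0%N); rewrite subrK.
  have : C * nrm h <= C by rewrite ler_piMr//; lra.
  lra.
have killl n : (n < p)%N -> u ^+ p * d n = 0.
  apply: (kill (fun y => u ^+ p * y) (nrm (u ^+ p))) => //.
  - by move=> y z; rewrite mulrDr.
  - by move=> k y; rewrite scalerAr.
  - by move=> y; exact: nrmM_le.
  - by move=> h f s h0 hr uf _ fE sc; apply: (bnd h f s).
have killr n : (n < p)%N -> d n * u ^+ p = 0.
  apply: (kill (fun y => y * u ^+ p) (nrm (u ^+ p))) => //.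
  - by move=> y z; rewrite mulrDl.
  - by move=> k y; rewrite scalerAl.
  - by move=> y; rewrite mulrC; exact: nrmM_le.
  - move=> h f s h0 hr uf fu fE sc; rewrite commrX; last by rewrite /GRing.comm uf fu.
    exact: (bnd h f s).
have eql : u ^+ p = u ^+ p.+1 * (- c 0%N).
  apply/eqP; rewrite mulrN -addr_eq0; apply/eqP.
  apply: (nrm_le_small_eq0 (K := M + nrm (u ^+ p.+1) * C) r0) => h h0 hr.
  have [f [s [f1 f2 fE sc]]] := exp h h0 hr; have [uf fu] := ufC _ _ f1 f2.
  have ufs : u ^+ p * f = u ^+ p * s.
    rewrite {1}fE mulrDr mulr_sumr big1 ?addr0// => i _.
    by rewrite -scalerAr killl ?scaler0.
  have -> : u ^+ p + u ^+ p.+1 * c 0%N = h *: (u ^+ p * f) - u ^+ p.+1 * (s - c 0%N).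
    rewrite mulrBr opprB addrCA [RHS]addrC; congr (_ + _).
    rewrite exprS -mulrA -ufs mulrA -exprS exprSr -mulrA uf mulrBr mulr1 -scalerAr.
    by rewrite subKr.
  rewrite (le_trans (nrmB_le _ _))// nrmZ [leRHS]mulrDl lerD//.
    by rewrite mulrC ler_wpM2r ?nrm_ge0//; apply: (bnd h f s).
  by rewrite (le_trans (nrmM_le _ _))// -mulrA ler_wpM2l ?nrm_ge0.
have eqr : u ^+ p = (- c 0%N) * u ^+ p.+1.
  apply/eqP; rewrite mulNr -addr_eq0; apply/eqP.
  apply: (nrm_le_small_eq0 (K := M + nrm (u ^+ p.+1) * C) r0) => h h0 hr.
  have [f [s [f1 f2 fE sc]]] := exp h h0 hr; have [uf fu] := ufC _ _ f1 f2.
  have ufs : f * u ^+ p = s * u ^+ p.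
    rewrite {1}fE mulrDl mulr_suml big1 ?addr0// => i _.
    by rewrite -scalerAl killr ?scaler0.
  have fup : f * u ^+ p = u ^+ p * f by apply: commrX; rewrite /GRing.comm uf fu.
  have -> : u ^+ p + c 0%N * u ^+ p.+1 = h *: (f * u ^+ p) - (s - c 0%N) * u ^+ p.+1.
    rewrite mulrBl opprB addrCA [RHS]addrC; congr (_ + _).
    rewrite exprSr [s * _]mulrA -ufs -mulrA -exprSr exprS mulrA fu mulrBl mul1r -scalerAl.
    by rewrite subKr.
  rewrite (le_trans (nrmB_le _ _))// nrmZ [leRHS]mulrDl lerD//.
    by rewrite fup mulrC ler_wpM2r ?nrm_ge0//; apply: (bnd h f s).
  rewrite (le_trans (nrmM_le _ _))// mulrC -mulrA ler_wpM2l ?nrm_ge0//.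
have [v h] := drazin_of_sided eql eqr.
by exists v, p.
Qed.

End Pole.

(** * Algebraic tensor products *)

Lemma linear_of (K : pzRingType) (V W : lmodType K) (f : V -> W) :
  linear f -> exists g : {linear V -> W}, g =1 f.
Proof.
move=> fl; pose g : {linear V -> W} := HB.pack f (GRing.isLinear.Build K V W _ f fl).
by exists g.
Qed.

Lemma bilinear_of (K : nzRingType) (U V W : lmodType K) (f : U -> V -> W) :
  (forall v, linear (f ^~ v)) -> (forall u, linear (f u)) ->
  exists g : {bilinear U -> V -> W}, forall u v, g u v = f u v.
Proof.
move=> fl fr.
pose g : {bilinear U -> V -> W} := HB.pack f
  (bilinear_isBilinear.Build K U V W *:%R *:%R f (fl, fr)).
by exists g.
Qed.

Section TensorProduct.
Variables (K : fieldType) (A B T : lmodType K) (t : {bilinear A -> B -> T}).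
Hypothesis tP : is_tensor_product t.

Lemma tensor_lift (W : lmodType K) (f : A -> B -> W) :
  (forall y, linear (f ^~ y)) -> (forall x, linear (f x)) ->
  exists g : {linear T -> W}, forall x y, g (t x y) = f x y.
Proof.
move=> fl fr; have [f' f'E] := bilinear_of fl fr.
by have [[g gE] _] := tP f'; exists g => x y; rewrite gE f'E.
Qed.

Lemma tensor_ext (W : lmodType K) (f g : T -> W) : linear f -> linear g ->
  (forall x y, f (t x y) = g (t x y)) -> f =1 g.
Proof.
move=> fl gl fg w.
have [f' f'E] := linear_of fl; have [g' g'E] := linear_of gl.
have [y c x x'|x c y y'|h hE] := @bilinear_of _ _ _ _ (fun x y => g (t x y)).
- by rewrite linearPl -!g'E linearP.
- by rewrite linearPr -!g'E linearP.
rewrite -f'E -g'E; apply: (tP h).2 => x y; rewrite hE ?g'E// f'E; exact: fg.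
Qed.

End TensorProduct.

(** * Drazin spectrum of a tensor *)

Section DrazinMore.
Variables (R : realType) (A : banachAlgType R[i]).
Implicit Types (x y g : A) (k l : R[i]).

Lemma drazin_invertibleZ k x : drazin_invertible x -> drazin_invertible (k *: x).
Proof.
move=> [y [m [h1 h2 h3]]]; have [->|k0] := eqVneq k 0.
  exists 0, 1%N; rewrite scale0r; split; rewrite ?expr1 ?mul0r ?mulr0//.
exists (k^-1 *: y), m; rewrite exprZn.
have kE : k ^+ m * k^-1 * k = k ^+ m by rewrite divfK.
split; rewrite -!(scalerAl, scalerAr) !scalerA.
- by rewrite h1 mulrC kE.
- by rewrite h2 mulVf// mulr1.
- by rewrite mulVf// mulfV// h3.
Qed.

Lemma drazin_invertible_scalar k : drazin_invertible (k%:A : A).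
Proof.
apply: drazin_invertibleZ; exists 1, 0%N; split; by rewrite ?expr0 ?mulr1.
Qed.

(** The idempotent [e = 1 - x y] is nonzero and killed by a power of [x]; the last nonzero [x^n e]
    is the vector. It is annihilated on both sides, as slicing from left and right requires. *)
Lemma drazin_eigenvector x : drazin_invertible x -> ~ invertible x ->
  exists g, [/\ g != 0, x * g = 0 & g * x = 0].
Proof.
move=> [y [m [h1 h2 h3]]] ninv; pose e := 1 - x * y.
have e0 : e != 0.
  apply/eqP => /eqP; rewrite subr_eq0 => /eqP xy1; apply: ninv; exists y.
  by split; rewrite -?h3 -xy1.
have xe : GRing.comm x e.
  apply: commrB; [exact: commr1|].
  by apply: commrM; [exact: commr_refl|].
have ex : exists n, x ^+ n * e == 0.
  by exists m; rewrite mulrBr mulr1 (drazin_expr_idem h1 h3) subrr.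
case: (ex_minnP ex) => -[|n] /eqP xn nmin.
  by rewrite expr0 mul1r in xn; rewrite xn eqxx in e0.
exists (x ^+ n * e); split.
- by apply/negP => /nmin; rewrite ltnn.
- by rewrite mulrA -exprS.
- by rewrite -mulrA -xe mulrA -exprSr.
Qed.

End DrazinMore.

(** * Elementary tensors and slices in the completion *)

Section BanachTensor.
Variables (R : realType) (A B C : banachAlgType R[i]) (T : normedModType R[i]).
Variables (t : {bilinear A -> B -> T}) (j : {linear T -> C}).
Hypothesis hC : tensor_completion t j.
Implicit Types (x g : A) (y b : B) (z : C) (w : T) (k l mu : R[i]).

Let J x y : C := j (t x y).

Let JM x y x' y' : J x y * J x' y' = J (x * x') (y * y').
Proof. exact: (tensor_completion_mul hC). Qed.

Let JZl k x y : J (k *: x) y = k *: J x y.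
Proof. by rewrite /J linearZl_LR linearZ. Qed.

Let JZr k x y : J x (k *: y) = k *: J x y.
Proof. by rewrite /J linearZr_LR linearZ. Qed.

Let JDl x x' y : J (x + x') y = J x y + J x' y.
Proof. by rewrite /J linearDl linearD. Qed.

Let JBl x x' y : J (x - x') y = J x y - J x' y.
Proof. by rewrite /J linearBl linearB. Qed.

Let JBr x y y' : J x (y - y') = J x y - J x y'.
Proof. by rewrite /J linearBr linearB. Qed.

Let J0l y : J 0 y = 0.
Proof. by rewrite /J linear0l linear0. Qed.

Let j_isom w : nrm (j w) = nrm w.
Proof. by have [h _] := tensor_completion_complete hC; rewrite /nrm h. Qed.

Let j_dense z (e : R) : 0 < e -> exists w, nrm (j w - z) < e.
Proof.
move=> e0; have [_ dns] := tensor_completion_complete hC.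
have zO : [set z' : C | nrm (z' - z) < e]^° z by apply/nbhs_nrmP; exists e.
have [||z' [z'O [w _ wz']]] := dns ([set z' : C | nrm (z' - z) < e]^°).
- by exists z.
- exact: open_interior.
by exists w; rewrite wz'; apply: (interior_subset z'O).
Qed.

(** On the dense range of [j], [J 1 1] is a left unit, so [J 1 1 - 1 = - (J 1 1 - 1) (j w - 1)] for
    every [w], and [j w] can approach [1]. *)
Let J11 : J 1 1 = 1.
Proof.
have unit_j w : J 1 1 * j w = j w.
  apply: (tensor_ext (tensor_completion_tensor hC)
    (f := fun w => J 1 1 * j w) (g := j)).
  - by move=> k w1 w2; rewrite linearP mulrDr scalerAr.
  - by move=> k w1 w2; rewrite linearP.
  - by move=> x y; rewrite JM !mul1r.
apply/eqP; rewrite -subr_eq0; apply/eqP/nrm_small_eq0 => e e0.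
have c0 : 0 < nrm (J 1 1 - 1) + 1 by rewrite ltr_wpDl ?nrm_ge0.
have [w hw] := j_dense 1 (divr_gt0 e0 c0).
have -> : J 1 1 - 1 = - ((J 1 1 - 1) * (j w - 1)).
  by rewrite mulrBr mulr1 mulrBl mul1r unit_j subrr sub0r opprK.
rewrite nrmN (le_lt_trans (nrmM_le _ _))//.
rewrite -[ltRHS](divfK (lt0r_neq0 c0)) mulrC mulrDr mulr1.
rewrite (@le_lt_trans _ _ (e / (nrm (J 1 1 - 1) + 1) * nrm (J 1 1 - 1)))//.
  by rewrite ler_wpM2r ?nrm_ge0// ltW.
by rewrite ltrDl divr_gt0.
Qed.

Let JX x y n : J x y ^+ n = J (x ^+ n) (y ^+ n).
Proof. by elim: n => [|n IH]; rewrite ?expr0 ?J11// !exprS IH JM. Qed.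

(** The map [w |-> t g (s w)] is [U (x) id] for the rank-one operator [U x = phi x *: g]. Uniformity
    bounds it, and the crossnorm property turns the norm of [t g (s w)] into that of [s w] times
    that of [g]. As [T] carries no product, multiplication by a tensor is expressed through
    preimages under [j]. *)
Let tensor_slice g : g != 0 -> exists (s : {linear T -> B}) (K : R),
  [/\ 0 <= K, forall w, nrm (s w) <= K * nrm w,
    forall x b w, exists w', j w' = J x b * j w /\ (x = 1 -> s w' = b * s w),
    forall x b w, exists w', j w' = j w * J x b /\ (x = 1 -> s w' = s w * b) &
    forall b, s (t g b) = b].
Proof.
move=> g0; have [phi [phiD phiZ phig [M phiM]]] := bounded_form_separating g0.
have tP := tensor_completion_tensor hC.
have [s sE] : exists s : {linear T -> B}, forall x y, s (t x y) = phi x *: y.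
  apply: (tensor_lift tP) => [y k x x'|x k y y'].
    by rewrite phiD phiZ scalerDl scalerA.
  by rewrite scalerDr !scalerA mulrC.
have [U UE] : exists U : {linear A -> A}, U =1 fun x => phi x *: g.
  by apply: linear_of => k x x'; rewrite phiD phiZ scalerDl scalerA.
have [UV UVE] : exists UV : {linear T -> T}, UV =1 fun w => t g (s w).
  by apply: linear_of => k w w'; rewrite linearP linearPr.
have Ubnd : bounded_map U.
  exists (`|M| * nrm g)%:C => x; rewrite UE !nrmE -rmorphM lecR nrmZ.
  rewrite mulrAC ler_wpM2r ?nrm_ge0// (le_trans (phiM x))//.
  by rewrite ler_wpM2r ?nrm_ge0// ler_norm.
have Vbnd : bounded_map (idfun : {linear B -> B}) by exists 1 => y; rewrite mul1r.
have UVt x y : UV (t x y) = t (U x) (idfun y).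
  by rewrite UVE sE UE linearZr_LR linearZl_LR.
pose Q : R := opnorm U * opnorm (idfun : {linear B -> B}).
have sQ w : nrm g * nrm (s w) <= Q * nrm w.
  have := tensor_completion_uniform hC Ubnd Vbnd UVt w.
  rewrite UVE (tensor_completion_crossnorm hC) !nrmE -!rmorphM lecR //.
have ng : 0 < nrm g by rewrite nrm_gt0.
exists s, (`|Q| / nrm g); split.
- by rewrite divr_ge0// ltW.
- move=> w; rewrite mulrAC ler_pdivlMr// mulrC (le_trans (sQ w))//.
  by rewrite ler_wpM2r ?nrm_ge0// ler_norm.
- move=> x b w.
  have [P PE] : exists P : {linear T -> T}, forall x' y, P (t x' y) = t (x * x') (b * y).
    apply: (tensor_lift tP) => [y k x1 x2|x1 k y y'].
      by rewrite mulrDr -scalerAr linearPl.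
    by rewrite mulrDr -scalerAr linearPr.
  exists (P w); split.
    apply: (tensor_ext tP (f := fun w => j (P w)) (g := fun w => J x b * j w)) => //.
    + by move=> k w1 w2; rewrite !linearP.
    + by move=> k w1 w2; rewrite linearP mulrDr scalerAr.
    + by move=> x' y; rewrite PE JM.
  move=> x1; apply: (tensor_ext tP (f := fun w => s (P w)) (g := fun w => b * s w)) => //.
  + by move=> k w1 w2; rewrite !linearP.
  + by move=> k w1 w2; rewrite linearP mulrDr scalerAr.
  + by move=> x' y; rewrite PE x1 mul1r !sE scalerAr.
- move=> x b w.
  have [P PE] : exists P : {linear T -> T}, forall x' y, P (t x' y) = t (x' * x) (y * b).
    apply: (tensor_lift tP) => [y k x1 x2|x1 k y y'].
      by rewrite mulrDl -scalerAl linearPl.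
    by rewrite mulrDl -scalerAl linearPr.
  exists (P w); split.
    apply: (tensor_ext tP (f := fun w => j (P w)) (g := fun w => j w * J x b)) => //.
    + by move=> k w1 w2; rewrite !linearP.
    + by move=> k w1 w2; rewrite linearP mulrDl scalerAl.
    + by move=> x' y; rewrite PE JM.
  move=> x1; apply: (tensor_ext tP (f := fun w => s (P w)) (g := fun w => s w * b)) => //.
  + by move=> k w1 w2; rewrite !linearP.
  + by move=> k w1 w2; rewrite linearP mulrDl scalerAl.
  + by move=> x' y; rewrite PE x1 mulr1 !sE scalerAl.
- by move=> b; rewrite sE phig scale1r.
Qed.

(* The slice map [phi (x) id] extended to the completion. *)
Let completed_slice g : g != 0 -> exists S : C -> B,
  [/\ forall b z, S (J 1 b * z) = b * S z, forall b z, S (z * J 1 b) = S z * b &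
    forall b, S (J g b) = b].
Proof.
move=> /tensor_slice[s [K [K0 sK sl sr sg]]].
(* The closure of the graph of [s] in the product of [C] and [B]. Boundedness of [s] makes it
   functional; density and completeness of [B] make it total. *)
pose P z y := forall e : R, 0 < e -> exists w, nrm (j w - z) < e /\ nrm (s w - y) < e.
have Pj w : P (j w) (s w) by move=> e e0; exists w; rewrite !subrr !nrm0.
have sjK w w' : nrm (s w - s w') <= K * nrm (j w - j w').
  by rewrite -!linearB j_isom.
have Puniq z y y' : P z y -> P z y' -> y = y'.
  move=> Py Py'; apply/eqP; rewrite -subr_eq0; apply/eqP/nrm_small_eq0 => e e0.
  have c0 : 0 < 2 * K + 2 by lra.
  have [w [w1 w2]] := Py _ (divr_gt0 e0 c0).
  have [w' [w1' w2']] := Py' _ (divr_gt0 e0 c0).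
  have : e = e / (2 * K + 2) * (2 * K + 2) by rewrite divfK ?gt_eqF.
  move: w1 w2 w1' w2'; set d := e / _ => w1 w2 w1' w2' ed.
  have := nrmBD_le (s w) y y'; have := nrmBD_le (s w') (s w) y'.
  have := nrmBD_le z (j w) (j w'); rewrite (nrmB y (s w)) (nrmB z (j w')) => h1 h2 h3.
  have h4 := sjK w w'.
  have h5 : K * nrm (j w - j w') <= K * (2 * d) by rewrite ler_wpM2l//; lra.
  lra.
have Pex z : exists y, P z y.
  have /choice[w wz] : forall n, exists w, nrm (j w - z) < n.+1%:R^-1.
    by move=> n; apply: j_dense; rewrite invr_gt0.
  have small (e : R) : 0 < e -> exists N, forall n, (N <= n)%N -> nrm (j (w n) - z) < e.
    move=> e0; have [N hN] := exists_nat_gt e^-1; exists N => n Nn.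
    rewrite (lt_trans (wz n))// invf_plt ?posrE// (lt_le_trans hN)//.
    by rewrite ler_nat ltnS.
  have [y sy] : exists y : B, (s \o w) @ \oo --> y.
    apply: cauchy_nrm_cvg => e e0.
    have c0 : 0 < 2 * K + 1 by lra.
    have [N hN] := small _ (divr_gt0 e0 c0); exists N => n m Nn Nm.
    have : e = e / (2 * K + 1) * (2 * K + 1) by rewrite divfK ?gt_eqF.
    move: (hN n Nn) (hN m Nm); set d := e / _ => hn hm ed.
    have h1 := sjK (w n) (w m).
    have h2 := nrmBD_le z (j (w n)) (j (w m)); rewrite (nrmB z (j (w m))) in h2.
    have h3 : K * nrm (j (w n) - j (w m)) <= K * (2 * d) by rewrite ler_wpM2l//; lra.
    rewrite /=; have := nrm_ge0 (j (w n) - z); lra.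
  exists y => e e0; have [N hN] := small e e0.
  have [N' hN'] := (cvg_nrmP _ _).1 sy e e0.
  exists (w (N + N')%N); split; first by rewrite hN// leq_addr.
  by apply: hN'; rewrite leq_addl.
have Pmul (z z' : C) (y y' : B) (c : R) : 0 <= c -> P z y ->
    (forall w, exists w', nrm (j w' - z') <= c * nrm (j w - z) /\
       nrm (s w' - y') <= c * nrm (s w - y)) -> P z' y'.
  move=> c0 Pzy h e e0.
  have c10 : 0 < c + 1 by lra.
  have [w [w1 w2]] := Pzy _ (divr_gt0 e0 c10).
  have [w' [w1' w2']] := h w; exists w'.
  have ed : e = e / (c + 1) * (c + 1) by rewrite divfK ?gt_eqF.
  have d0 := divr_gt0 e0 c10.
  move: w1 w2 ed d0; set d := e / _ => w1 w2 ed d0.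
  have h1 : c * nrm (j w - z) <= c * d by rewrite ler_wpM2l// ltW.
  have h2 : c * nrm (s w - y) <= c * d by rewrite ler_wpM2l// ltW.
  by split; lra.
have [S SP] := choice Pex.
exists S; split.
- move=> b z; apply: (Puniq _ _ _ (SP _)).
  apply: (Pmul z _ (S z) _ (nrm (J 1 b) + nrm b)) => //.
    by rewrite addr_ge0 ?nrm_ge0.
  move=> w; have [w' [jw' /(_ erefl) sw']] := sl 1 b w; exists w'.
  rewrite jw' sw' -!mulrBr; split.
    by rewrite (le_trans (nrmM_le _ _))// ler_wpM2r ?nrm_ge0// lerDl nrm_ge0.
  by rewrite (le_trans (nrmM_le _ _))// ler_wpM2r ?nrm_ge0// lerDr nrm_ge0.
- move=> b z; apply: (Puniq _ _ _ (SP _)).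
  apply: (Pmul z _ (S z) _ (nrm (J 1 b) + nrm b)) => //.
    by rewrite addr_ge0 ?nrm_ge0.
  move=> w; have [w' [jw' /(_ erefl) sw']] := sr 1 b w; exists w'.
  rewrite jw' sw' -!mulrBl; split.
    by rewrite (le_trans (nrmM_le _ _))// mulrC ler_wpM2r ?nrm_ge0// lerDl nrm_ge0.
  by rewrite (le_trans (nrmM_le _ _))// mulrC ler_wpM2r ?nrm_ge0// lerDr nrm_ge0.
- by move=> b; apply: (Puniq _ _ _ (SP _)); have := Pj (t g b); rewrite sg.
Qed.

Variables (a : A) (b : B).

(** Next to [J g 1], on either side, [X] acts as [y = l (b - k)] in the second factor. Multiplying
    [X^m = X^(m+1) z] on the left by [J g 1], and its mirror image on the right, makes every power
    of [X] a power of [y], which [S] can pull out. *)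
Lemma drazin_invertible_of_tensor g l k : l != 0 -> g != 0 ->
  (a - l%:A) * g = 0 -> g * (a - l%:A) = 0 ->
  drazin_invertible (J a b - (l * k)%:A) -> drazin_invertible (b - k%:A).
Proof.
move=> l0 /completed_slice[S [Sl Sr Sg]] ag ga [z [m [z1 z2 z3]]].
set X := J a b - _ in z1 z2 z3; pose y := l *: (b - k%:A).
have yE : y = l *: b - (l * k)%:A by rewrite /y scalerBr scalerA.
have agE : a * g = l *: g.
  by apply/eqP; rewrite -subr_eq0 -[l *: g]mul1r -scalerAr scalerAl -mulrBl ag.
have gaE : g * a = l *: g.
  by apply/eqP; rewrite -subr_eq0 -[l *: g]mulr1 -scalerAl scalerAr -mulrBr ga.
have XJ c : X * J g c = J g (y * c).
  rewrite mulrBl JM agE -scalerAl mul1r yE mulrBl -!scalerAl mul1r JBr !JZr.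
  by rewrite JZl.
have JX' c : J g c * X = J g (c * y).
  rewrite mulrBr JM gaE -scalerAr mulr1 yE mulrBr -!scalerAr mulr1 JBr !JZr.
  by rewrite JZl.
have XnJ n : X ^+ n * J g 1 = J g (y ^+ n).
  elim: n => [|n IH]; first by rewrite !expr0 mul1r.
  by rewrite exprS -mulrA IH XJ -exprS.
have JXn n : J g 1 * X ^+ n = J g (y ^+ n).
  elim: n => [|n IH]; first by rewrite !expr0 mulr1.
  by rewrite exprSr mulrA IH JX' -exprSr.
have Jsl c : J g c = J 1 c * J g 1 by rewrite JM mul1r mulr1.
have Jsr c : J g c = J g 1 * J 1 c by rewrite JM mul1r mulr1.
have Xz : X ^+ m = X ^+ m.+1 * z := drazin_expr z1 z3.
have zX : X ^+ m = z * X ^+ m.+1.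
  rewrite {1}Xz; apply: commr_sym; apply: commrX; exact/esym.
have ey : y ^+ m = y ^+ m.+1 * S (J g 1 * z).
  by rewrite -Sl mulrA -Jsl -JXn -mulrA -Xz JXn Sg.
have ey' : y ^+ m = S (z * J g 1) * y ^+ m.+1.
  by rewrite -Sr -mulrA -Jsr -XnJ mulrA -zX XnJ Sg.
have [v hv] := drazin_of_sided ey ey'.
have -> : b - k%:A = l^-1 *: y by rewrite scalerA mulVf// scale1r.
by apply: drazin_invertibleZ; exists v, m.
Qed.

(** The property [drazin_on (J g 1) X] is additive in [g], so it may be checked on the blocks of
    [a]; the instance [g = 1] is the claim. *)
Lemma drazin_invertible_tensor mu :
  (forall l, drazin_invertible (a - l%:A)) ->
  (exists s : seq R[i], forall l, spectrum a l -> l \in s) ->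
  (forall l, spectrum a l -> l != 0 -> drazin_invertible (b - (mu / l)%:A)) ->
  drazin_invertible (J a b - mu%:A).
Proof.
move=> aD afin bD; set X := J a b - _.
suff [_ [m [y [z [yE zE]]]]] : drazin_on (J 1 1) X.
  rewrite J11 mul1r in yE zE.
  by have [v hv] := drazin_of_sided yE zE; exists v, m.
apply: (@algebraic_ind _ _ a (fun g => drazin_on (J g 1) X)) => //.
- by rewrite J0l; exact: drazin_on0.
- by move=> g h; rewrite JDl; exact: drazin_onD.
move=> l m g al ag ug.
have : drazin_invertible (l *: b - mu%:A).
  (* At [l = 0] only the scalar [- mu] remains, Drazin invertible even for [mu = 0]; no condition on
     [b] arises. *)
  have [->|l0] := eqVneq l 0.
    by rewrite scale0r sub0r -scaleNr; exact: drazin_invertible_scalar.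
  have -> : l *: b - mu%:A = l *: (b - (mu / l)%:A).
    by rewrite scalerBr scalerA mulrC divfK.
  exact/drazin_invertibleZ/bD.
set w' := l *: b - _ => -[v' [n [v1 v2 v3]]].
have bw : GRing.comm b w'.
  apply: commrB; first by rewrite /GRing.comm -scalerAr -scalerAl.
  by rewrite /GRing.comm -scalerAr -scalerAl mulr1 mul1r.
have bv : GRing.comm b v' := drazin_comm v1 v2 v3 bw.
have gu : GRing.comm g (a - l%:A).
  apply: commrB; first exact: commr_sym.
  by rewrite /GRing.comm -scalerAr -scalerAl mulr1 mul1r.
have -> : X = J 1 w' + J (a - l%:A) b.
  by rewrite /w' JBl JBr !JZr JZl J11 [RHS]addrC subrKA.
apply: (@drazin_on_nilpotentD _ _ _ _ (J 1 v') n m).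
- by rewrite /GRing.comm !JM !mul1r !mulr1.
- by rewrite /GRing.comm !JM mul1r mulr1 gu.
- by rewrite /GRing.comm !JM !mul1r !mulr1.
- by rewrite /GRing.comm !JM mul1r mulr1 bw.
- by rewrite /GRing.comm !JM mul1r mulr1 bv.
- by rewrite JX JM ug J0l.
- by rewrite JX !JM expr1n !mul1r v1.
- by rewrite !JM !mul1r v2.
- by rewrite !JM v3.
Qed.

Lemma drazin_spectrum_tensor_poles : spectrum a = poles a ->
  poles a <> [set 0] -> drazin_spectrum b <> set0 ->
  (drazin_spectrum (J a b) =
     set_mul (spectrum a) (drazin_spectrum b) `|`
     set_mul (drazin_spectrum a) (spectrum b) <->
   ~ poles a 0 \/ ~ drazin_resolvent_set b 0).
Proof.
move=> aP aP0 bD0.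
have aD l : drazin_invertible (a - l%:A).
  have [al|] := pselect (spectrum a l).
    by apply: pole_drazin_invertible; rewrite -aP.
  move=> /contrapT[y [y1 y2]]; exists y, 0%N.
  by rewrite expr0 mul1r y1 y2 mul1r.
have afin : exists s : seq R[i], forall l, spectrum a l -> l \in s.
  by apply: isolated_spectrum_finite => l; rewrite {1}aP => -[].
have key mu : drazin_spectrum (J a b) mu <->
    exists l, [/\ spectrum a l, l != 0 & drazin_spectrum b (mu / l)].
  split=> [|[l [al l0 bl]] xD].
    apply: contraPP => h; rewrite /drazin_spectrum /= => nD; apply: nD.
    apply: drazin_invertible_tensor => // l al l0.
    by apply: contrapT => nb; apply: h; exists l.
  have [g [g0 ag ga]] := drazin_eigenvector (aD l) al.
  apply: bl; apply: (drazin_invertible_of_tensor l0 g0 ag ga).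
  by rewrite mulrC divfK.
split=> [XD|h].
  apply: contrapT => /not_orP[/contrapT a0 /contrapT b0].
  (* [D] contains [0] as [0] times any point of sigma_DR(b), while by [key] a spectrum containing
     [0] forces [0 / l = 0] into sigma_DR(b). *)
  have [l' [_ _]] : exists l, [/\ spectrum a l, l != 0 & drazin_spectrum b (0 / l)].
    have /set0P[l bl] : drazin_spectrum b != set0 by apply/eqP.
    apply/key; rewrite XD; left; exists 0; first by rewrite aP.
    by exists l; rewrite ?mul0r.
  by rewrite mul0r.
apply/seteqP; split=> mu.
  move=> /key[l [al l0 bl]]; left; exists l => //; exists (mu / l) => //.
  by rewrite mulrC divfK.
move=> [[k ak [l bl <-]]|[k ak]]; last by case: ak.
apply/key; have [k0|k0] := eqVneq k 0; last first.
  by exists k; split=> //; rewrite mulrC mulKf.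
rewrite k0 in ak *; rewrite mul0r.
have [|] := h; first by rewrite -aP.
move=> /contrapT b0.
(* Now [0] lies in sigma(a) and in sigma_DR(b). To reach [0] through [key] a nonzero spectral point
   is required, and sigma(a) is not reduced to [0]. *)
have [l' al' l'0] : exists2 l', spectrum a l' & l' != 0.
  apply: contrapT => nl; apply: aP0; rewrite -aP; apply/seteqP; split=> [l' al'|_ -> //].
  apply: contrapT => /eqP l'0; apply: nl; exists l' => //.
by exists l'; rewrite mul0r.
Qed.

End BanachTensor.

(** * Exchange of the two factors, and the theorem *)

Lemma tensor_completion_swap (R : realType) (A B C : banachAlgType R[i])
    (T : normedModType R[i]) (t : {bilinear A -> B -> T}) (j : {linear T -> C})
    (t' : {bilinear B -> A -> T}) : (forall y x, t' y x = t x y) ->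
  tensor_completion t j -> tensor_completion t' j.
Proof.
move=> t'E [tP cross unif compl tM]; split=> //.
- move=> W f.
  have [x c y y'|y c x x'|f' f'E] := @bilinear_of _ _ _ _ (fun x y => f y x).
  + exact: linearPr.
  + exact: linearPl.
  have [[g gE] uniq] := tP W f'; split; first by exists g => y x; rewrite t'E gE f'E.
  by move=> g1 g2 g1E g2E; apply: uniq => x y; rewrite f'E -t'E.
- by move=> y x; rewrite t'E cross mulrC.
- move=> U V UV Ub Vb UVE z; rewrite [(opnorm U)%:C * _]mulrC.
  by apply: unif => // x y; rewrite -!t'E.
- by move=> y y' x x'; rewrite !t'E tM.
Qed.

Lemma set_mulC (K : comPzRingType) (S S' : set K) : set_mul S S' = set_mul S' S.
Proof.
by apply/seteqP; split=> _ [x Sx [y Sy <-]]; exists y => //; exists x => //; rewrite mulrC.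
Qed.

Theorem theorem4p2 (R : realType) (A B C : banachAlgType R[i])
    (T : normedModType R[i]) (t : {bilinear A -> B -> T}) (j : {linear T -> C})
    (hC : tensor_completion t j) (a : A) (b : B) :
  let D := set_mul (spectrum a) (drazin_spectrum b) `|`
           set_mul (drazin_spectrum a) (spectrum b) in
  (spectrum a = poles a -> poles a <> [set 0] -> drazin_spectrum b <> set0 ->
     (drazin_spectrum (j (t a b)) = D <->
        ~ poles a 0 \/ ~ drazin_resolvent_set b 0)) /\
  (drazin_spectrum a <> set0 -> spectrum b = poles b -> poles b <> [set 0] ->
     (drazin_spectrum (j (t a b)) = D <->
        ~ drazin_resolvent_set a 0 \/ ~ poles b 0)).
Proof.
split; first exact: drazin_spectrum_tensor_poles.
move=> a0 bP bP0.
have [x c y y'|y c x x'|t' t'E] := @bilinear_of _ _ _ _ (fun y x => t x y).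
- exact: linearPr.
- exact: linearPl.
have := drazin_spectrum_tensor_poles (tensor_completion_swap t'E hC) bP bP0 a0.
by rewrite t'E setUC set_mulC [X in _ `|` X]set_mulC or_comm.
Qed.
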